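(* Let $K$ be an infinite field. Then any finitely generated graded $K[x_1,\ldots,x_n]$-module $M$ has, possibly after a generic linear change of coordinates, a filtered Stanley decomposition, that is, with $R_0=K$ and $R_i=K[x_{n-i+1},\ldots,x_n]$ for $1\le i\le n$, $M$ can be written as a (graded) vector space as $$M=\bigoplus_{i=0}^nN_i,$$ where each $N_i\subset M$ is a free finitely generated graded $R_i$-submodule. If $K$ is a finite field, such a decomposition exists over a certain finite extension of $K$ (i.e. for $M\otimes_KK'$ over $K'[x_1,\ldots,x_n]$ for some finite extension $K'/K$).
   Context: $K[x_1,\ldots,x_n]$ carries the standard grading by total degree. $M$ is viewed as an $R_i$-module by restriction of scalars. *)

(* Defs.v *)
(* Mathematical Components world (with multinomials and mathcomp-classical). *)
From HB Require Import structures.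
From mathcomp Require Export all_boot all_order all_algebra all_field.
From mathcomp Require Export classical_sets cardinality.
From mathcomp Require Export mpoly.

Set Implicit Arguments.
Unset Strict Implicit.
Unset Printing Implicit Defensive.

Import GRing.Theory.

Local Open Scope ring_scope.

(* Variables are indexed from 0: 'X_i (i : 'I_n) is x_(i+1). *)

(* [Md d] is the degree-d component; components are indexed by all integers. *)
Record is_grading (K : fieldType) (n : nat) (M : lmodType {mpoly K[n]})
    (Md : int -> set M) : Prop := IsGrading {
  grading0 : forall d, Md d 0;
  gradingB : forall d u v, Md d u -> Md d v -> Md d (u - v);
  gradingM : forall (e : nat) d (p : {mpoly K[n]}) u,
    p \is e.-homog -> Md d u -> Md (e%:Z + d) (p *: u);
  grading_span : forall u, exists (s : seq int) (c : int -> M),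
    [/\ uniq s, forall d, Md d (c d) & u = \sum_(d <- s) c d];
  grading_free : forall (s : seq int) (c : int -> M), uniq s ->
    (forall d, Md d (c d)) -> \sum_(d <- s) c d = 0 ->
    forall d, d \in s -> c d = 0 }.

Definition fin_generated (R : pzRingType) (M : lmodType R) : Prop :=
  exists (k : nat) (e : 'I_k -> M),
    forall u, exists p : 'I_k -> R, u = \sum_j p j *: e j.

Definition new_coord (K : fieldType) (n : nat) (g : 'M[K]_n) :
    n.-tuple {mpoly K[n]} :=
  [tuple \sum_j g i j *: 'X_j | i < n].

(* The subring R_i = K[y_(n-i+1), ..., y_n], where y = g x: polynomials in the
   last i variables (those of 0-based index at least n - i), evaluated at y. *)
Definition last_coord_ring (K : fieldType) (n : nat) (g : 'M[K]_n) (i : nat) :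
    set {mpoly K[n]} :=
  fun q => exists2 p : {mpoly K[n]},
    forall m, m \in msupp p -> forall j : 'I_n, (j < n - i)%N -> m j = 0%N
    & q = p \mPo new_coord g.

Record is_graded_submod (K : fieldType) (n : nat) (M : lmodType {mpoly K[n]})
    (Md : int -> set M) (R : set {mpoly K[n]}) (N : set M) : Prop :=
  IsGradedSubmod {
  submod0 : N 0;
  submodD : forall u v, N u -> N v -> N (u + v);
  submodM : forall q u, R q -> N u -> N (q *: u);
  submod_homog : forall u, N u -> exists (s : seq int) (c : int -> M),
    [/\ uniq s, forall d, Md d (c d) /\ N (c d) & u = \sum_(d <- s) c d] }.

(* Free of finite rank as a graded module: there is a finite homogeneous
   basis. *)
Definition has_homog_basis (K : fieldType) (n : nat)
    (M : lmodType {mpoly K[n]}) (Md : int -> set M) (R : set {mpoly K[n]})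
    (N : set M) : Prop :=
  exists (k : nat) (e : 'I_k -> M),
    [/\ forall j, N (e j) /\ exists d, Md d (e j),
        forall u, N u -> exists q : 'I_k -> {mpoly K[n]},
          (forall j, R (q j)) /\ u = \sum_j q j *: e j
      & forall q : 'I_k -> {mpoly K[n]}, (forall j, R (q j)) ->
          \sum_j q j *: e j = 0 -> forall j, q j = 0].

(* The decomposition is automatically one of graded vector spaces, the N_i
   being graded submodules. *)
Definition filtered_Stanley_decomposition (K : fieldType) (n : nat)
    (M : lmodType {mpoly K[n]}) (Md : int -> set M) (g : 'M[K]_n)
    (N : 'I_n.+1 -> set M) : Prop :=
  [/\ forall i : 'I_n.+1,
        is_graded_submod Md (last_coord_ring g i) (N i) /\
        has_homog_basis Md (last_coord_ring g i) (N i),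
      forall u : M, exists v : 'I_n.+1 -> M,
        (forall i, N i (v i)) /\ u = \sum_i v i
    & forall v : 'I_n.+1 -> M, (forall i, N i (v i)) ->
        \sum_i v i = 0 -> forall i, v i = 0].

(* P holds for generic g in GL_n(K): it holds on a principal Zariski open
   subset {F <> 0} of GL_n(K); this subset is nonempty when K is infinite. *)
Definition generic_GL (K : fieldType) (n : nat) (P : 'M[K]_n -> Prop) : Prop :=
  exists2 F : {mpoly K[n * n]}, F != 0 &
    forall g : 'M[K]_n, g \in unitmx -> F.@[mxvec g 0] != 0 -> P g.

(* Maps M x L -> V bilinear over K, for V a K-vector space with scaling [sc];
   K acts on the module M through constant polynomials. *)
Definition bilinear_over (K : fieldType) (n : nat) (M : lmodType {mpoly K[n]})
    (L : fieldExtType K) (V : zmodType) (sc : K -> V -> V)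
    (b : M -> L -> V) : Prop :=
  [/\ forall u v a, b (u + v) a = b u a + b v a,
      forall u a a', b u (a + a') = b u a + b u a',
      forall c u a, b (c%:MP *: u) a = sc c (b u a)
    & forall c u a, b u (c *: a) = sc c (b u a)].

(* t : M x L -> M' exhibits M' as the tensor product of M and L over K, with
   its structure of module over L[x_1, ..., x_n]. *)
Record is_base_extension (K : fieldType) (n : nat) (M : lmodType {mpoly K[n]})
    (L : fieldExtType K) (M' : lmodType {mpoly L[n]}) (t : M -> L -> M') :
    Prop := IsBaseExtension {
  base_ext_bilinear :
    bilinear_over (fun (c : K) (w : M') => (c%:A : L)%:MP_[n] *: w) t;
  base_ext_exists : forall (V : lmodType K) (b : M -> L -> V),
    bilinear_over (fun c w => c *: w) b -> exists f : M' -> V,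
      [/\ forall v w, f (v + w) = f v + f w,
          forall (c : K) w, f ((c%:A : L)%:MP_[n] *: w) = c *: f w
        & forall u a, f (t u a) = b u a];
  base_ext_unique : forall (V : lmodType K) (f f' : M' -> V),
    (forall v w, f (v + w) = f v + f w) ->
    (forall (c : K) w, f ((c%:A : L)%:MP_[n] *: w) = c *: f w) ->
    (forall v w, f' (v + w) = f' v + f' w) ->
    (forall (c : K) w, f' ((c%:A : L)%:MP_[n] *: w) = c *: f' w) ->
    (forall u a, f (t u a) = f' (t u a)) -> forall w, f w = f' w;
  base_ext_scale : forall (p : {mpoly K[n]}) (a : L) u a',
    (a%:MP_[n] * map_mpoly (in_alg L) p) *: t u a' = t (p *: u) (a * a') }.

Definition base_ext_grading (K : fieldType) (n : nat)
    (M : lmodType {mpoly K[n]}) (Md : int -> set M) (L : fieldExtType K)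
    (M' : lmodType {mpoly L[n]}) (t : M -> L -> M') : int -> set M' :=
  fun d w => exists (k : nat) (u : 'I_k -> M) (a : 'I_k -> L),
    (forall j, Md d (u j)) /\ w = \sum_j t (u j) (a j).

(* Main.v *)
Require Import Defs.
From HB Require Import structures.
From mathcomp Require Import boolp freeg fraction generic_quotient zify.
Set Implicit Arguments.
Unset Strict Implicit.
Unset Printing Implicit Defensive.
Import GRing.Theory.
Local Open Scope ring_scope.

(** Fix homogeneous generators e_j of M and linear coordinates y = g x.  A term
    is a product y^mu e_j; call it standard if it is not a combination of the
    terms of the same degree that precede it in the reverse lexicographic order
    (those that involve the last variables more).  The standard terms form a
    basis of M over K, and divisors of standard terms are standard
    (standard_span, standard_free_deg, standard_down).  So it is enough to cut
    the set of standard terms into finitely many cones, each consisting of the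
    products of one term with all the monomials in the last i variables.

    This works as soon as there is a degree D such that a standard term of
    degree at least D involving no variable after y_i stays standard when it is
    multiplied by y_i (tail_closed).  The vertices of the cones are then the
    standard terms of degree D, a vertex whose last variable is y_c having
    y_c, ..., y_{n-1} as its free variables, together with the terms of
    degree less than D, which have no free variable (head_exists, head_unique,
    head_cone); this gives the decomposition in cone_decomposition.

    For the generic matrix, whose entries t_ij are indeterminates, such a D
    exists.  The reverse lexicographic order turns a failure of tail_closed at a
    term x into an element u, with leading term x, such that y_i u lies in
    Q = (y_{i+1}, ..., y_{n-1}) M.  As y_i = sum_j t_ij x_j and Q does not
    involve the t_ij, comparing coefficients of powers of t_ij shows that u is
    sent into Q by a power of each x_j (tail_sub_annihilated), hence by a power
    of each y_l.  So x has a nonstandard multiple by a power of y_l for every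
    l <= i (generic_quasi_stable).  By Dickson's lemma, from a certain bound on the
    exponent of y_l cannot influence whether a term is standard; the exponents
    of x are therefore below that bound, and its degree is bounded
    (generic_tail_closed).

    It remains to pass from the generic matrix to a given g.  The relations that
    make the nonstandard terms of degree D nonstandard have finitely many
    coefficients, which are fractions in the t_ij.  Where the product F of the
    denominators does not vanish they can be specialized, so that a standard
    term of degree D for g is standard generically.  Every standard term for g
    of larger degree then lies in one of the generic cones; as the number of
    standard terms of a given degree is the dimension of the homogeneous
    component of M (size_standard_list), both sets of standard terms agree from
    degree D on, and tail_closed holds for g (tail_closed_open).

    The polynomial F has coefficients in K and serves all the extensions of K at
    once: M is extended along any K -> R by means of a basis of M over K.  If K is
    finite, a finite extension large enough to contain a point where F and the
    determinant do not vanish concludes. *)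

(** * Linear algebra over the field of constants *)

Section ConstantSpan.
Variables (k : comNzRingType) (n : nat) (P : lmodType {mpoly k[n]}).
Variables (I : Type) (f : I -> P).

(** The scalars act on P through the constant polynomials. *)
Inductive kspan (S : I -> Prop) : P -> Prop :=
| kspan0 : kspan S 0
| kspan_cons c i u : S i -> kspan S u -> kspan S (c%:MP *: f i + u).

Lemma kspanD S u v : kspan S u -> kspan S v -> kspan S (u + v).
Proof.
move=> Su Sv; elim: Su => [|c i w Si _ IH]; first by rewrite add0r.
by rewrite -addrA; apply: kspan_cons.
Qed.

Lemma kspanZ S c u : kspan S u -> kspan S (c%:MP *: u).
Proof.
elim=> [|d i w Si _ IH]; first by rewrite scaler0; constructor.
by rewrite scalerDr scalerA -mpolyCM; apply: kspan_cons.
Qed.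

Lemma kspanN S u : kspan S u -> kspan S (- u).
Proof. by move=> Su; rewrite -scaleN1r -mpolyC1 -mpolyCN; apply: kspanZ. Qed.

Lemma kspanB S u v : kspan S u -> kspan S v -> kspan S (u - v).
Proof. by move=> Su Sv; apply: kspanD => //; apply: kspanN. Qed.

Lemma kspan_gen S i : S i -> kspan S (f i).
Proof.
move=> Si; rewrite -[f i]scale1r -mpolyC1 -[_ *: _]addr0.
by apply: kspan_cons => //; constructor.
Qed.

Lemma kspan_sum S (J : Type) (s : seq J) (A : pred J) F :
  (forall j, A j -> kspan S (F j)) -> kspan S (\sum_(j <- s | A j) F j).
Proof. by move=> H; apply: (big_ind (kspan S)); [left|exact: kspanD|]. Qed.

Lemma kspan_sum_mem S (J : eqType) (s : seq J) F :
  (forall j, j \in s -> kspan S (F j)) -> kspan S (\sum_(j <- s) F j).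
Proof.
by move=> H; rewrite big_seq_cond; apply: kspan_sum => j /andP[/H].
Qed.

Lemma kspan_mono (S S' : I -> Prop) u :
  (forall i, S i -> S' i) -> kspan S u -> kspan S' u.
Proof.
by move=> SS'; elim=> [|c i w /SS' Si _ IH]; [left|apply: kspan_cons].
Qed.

End ConstantSpan.

Lemma kspan_trans (k : comNzRingType) (n : nat) (P : lmodType {mpoly k[n]})
    (I J : Type) (f : I -> P) (h : J -> P) (S : I -> Prop) (S' : J -> Prop) u :
  (forall i, S i -> kspan h S' (f i)) -> kspan f S u -> kspan h S' u.
Proof.
move=> H; elim=> [|c i w Si _ IH]; first by left.
by apply: kspanD => //; apply: kspanZ; apply: H.
Qed.

Section Independence.
Variables (k : comNzRingType) (n : nat) (P : lmodType {mpoly k[n]}).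
Variables (I : eqType) (f : I -> P).

Definition kfree (S : I -> Prop) := forall (s : seq I) (c : I -> k),
  uniq s -> (forall i, i \in s -> S i) ->
  \sum_(i <- s) (c i)%:MP *: f i = 0 -> forall i, i \in s -> c i = 0.

Lemma kfree_mono (S S' : I -> Prop) :
  (forall i, S i -> S' i) -> kfree S' -> kfree S.
Proof. by move=> SS' fr s c us sS; apply: fr => // i /sS /SS'. Qed.

Lemma kspanP S u : kspan f S u -> exists (s : seq I) (c : I -> k),
  [/\ uniq s, forall i, i \in s -> S i & u = \sum_(i <- s) (c i)%:MP *: f i].
Proof.
elim=> [|d i w Si _ [s [c [us sS ->]]]].
  by exists [::], (fun=> 0); split => //; rewrite big_nil.
have [is_|nis] := boolP (i \in s); last first.
  exists (i :: s), (fun j => if j == i then d else c j); split => //=.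
  - by rewrite nis.
  - by move=> j; rewrite inE => /orP[/eqP->|/sS].
  rewrite big_cons eqxx; congr (_ + _); rewrite !big_seq; apply: eq_bigr => j js.
  by case: eqP js nis => // -> ->.
exists s, (fun j => if j == i then d + c j else c j); split => //.
rewrite !(bigD1_seq i) //= eqxx mpolyCD scalerDl -addrA; congr (_ + (_ + _)).
by apply: eq_bigr => j /negPf ->.
Qed.

Lemma kfree_disjoint (S S' : I -> Prop) u : (forall i, S i -> ~ S' i) ->
  kfree (fun i => S i \/ S' i) -> kspan f S u -> kspan f S' u -> u = 0.
Proof.
move=> dis fr /kspanP[s [c [us sS ->]]] /kspanP[s' [c' [us' sS' e]]].
have disj i : i \in s -> i \in s' -> False by move=> /sS Si /sS'; exact: dis Si.
have := fr (s ++ s') (fun i => if i \in s then c i else - c' i).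
rewrite cat_uniq us us' andbT /= => /(_ _ _ _) H.
rewrite big_seq big1 // => i is_.
have := H _ _ _ i; rewrite mem_cat is_ => ->; rewrite ?mpolyC0 ?scale0r //.
- by apply/hasPn => j js'; apply/negP => js; exact: disj js js'.
- by move=> j; rewrite mem_cat => /orP[/sS|/sS']; [left|right].
rewrite big_cat /=; apply/eqP; rewrite addr_eq0 -sumrN; apply/eqP.
rewrite big_seq (eq_bigr (fun i => (c i)%:MP *: f i)) -?big_seq; last first.
  by move=> j ->.
rewrite e !big_seq; apply: eq_bigr => j js'.
by case: ifP => [/disj/(_ js')//|_]; rewrite mpolyCN scaleNr opprK.
Qed.

End Independence.

(** Steinitz: the coefficient matrix of the first family in the second one has
    independent rows. *)
Lemma kfree_size_le (k : fieldType) (n : nat) (P : lmodType {mpoly k[n]})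
    (I J : eqType) (f : I -> P) (h : J -> P) (s : seq I) (s' : seq J) :
  uniq s -> kfree f (fun i => i \in s) ->
  (forall i, i \in s -> kspan h (fun j => j \in s') (f i)) ->
  (size s <= size s')%N.
Proof.
move=> us fr sp.
have sp' (i : 'I_(size s)) : exists r : 'rV[k]_(size s'),
    f (tnth (in_tuple s) i) = \sum_j (r 0 j)%:MP *: h (tnth (in_tuple s') j).
  have /sp : tnth (in_tuple s) i \in s by exact: mem_tnth.
  elim: {i}(f _) / => [|c j w js' _ [r ->]].
    by exists 0; rewrite big1 // => j _; rewrite mxE mpolyC0 scale0r.
  have /tnthP[l ->] : j \in in_tuple s' by [].
  exists (r + c *: delta_mx 0 l).
  rewrite [in RHS](bigD1 l) //= [in LHS](bigD1 l) //= !mxE !eqxx mulr1.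
  rewrite mpolyCD scalerDl addrCA addrA; congr (_ + _).
  by apply: eq_bigr => q /negPf ql; rewrite !mxE ql andbF mulr0 addr0.
have [r rP] := choice sp'.
pose A := \matrix_(i < size s) r i.
suff /eqP <- : row_free A by exact: rank_leq_col.
apply: inj_row_free => v vA.
pose c x := if insub (index x s) is Some i then v 0 i else 0.
have ci (i : 'I_(size s)) : c (tnth (in_tuple s) i) = v 0 i.
  by rewrite /c (tnth_nth (tnth (in_tuple s) i)) /= index_uniq // valK.
suff H : \sum_(i <- s) (c i)%:MP *: f i = 0.
  apply/rowP => i; rewrite -ci mxE; apply: (fr _ _ _ _ H) => //; exact: mem_tnth.
rewrite -[X in \sum_(i <- X) _]/(tval (in_tuple s)) big_tuple.
under eq_bigr => i _ do rewrite ci rP scaler_sumr.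
rewrite exchange_big /= big1 // => j _.
have := congr1 (fun B : 'rV_(size s') => (B 0 j)%:MP_[n] *: h (tnth (in_tuple s') j)) vA.
rewrite !mxE mpolyC0 scale0r raddf_sum scaler_suml /=; apply: etrans.
by apply: eq_bigr => i _; rewrite scalerA -mpolyCM !mxE.
Qed.

Lemma sum_undup_fibers (V : nmodType) (I J : eqType) (dg : I -> J) (s : seq I)
    (F : I -> V) :
  \sum_(d <- undup (map dg s)) \sum_(i <- s | dg i == d) F i = \sum_(i <- s) F i.
Proof.
rewrite (exchange_big_dep xpredT) //= big_seq [RHS]big_seq; apply: eq_bigr => x xs.
rewrite -big_filter (eq_filter (a2 := pred1 (dg x))) => [|d]; last by rewrite /= eq_sym.
by rewrite filter_pred1_uniq ?undup_uniq ?mem_undup ?map_f // big_seq1.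
Qed.

(** * Monomials of a free module and the reverse lexicographic order *)

Section Terms.
Variables (n r : nat) (dlt : 'I_r -> nat).

Definition term := ('X_{1..n} * 'I_r)%type.

Definition tdeg (x : term) : nat := (mdeg x.1 + dlt x.2)%N.
Definition tmul (m : 'X_{1..n}) (x : term) : term := ((m + x.1)%MM, x.2).

(** The exponents are compared without regard to the degrees of the generators,
    so that involving a later variable always makes a term smaller. *)
Definition revlex_lt (x y : term) : Prop :=
  (exists i : 'I_n, (y.1 i < x.1 i)%N /\
     forall j : 'I_n, (i < j)%N -> x.1 j = y.1 j)
  \/ (x.1 = y.1 /\ (x.2 < y.2)%N).

Lemma tdegM m x : tdeg (tmul m x) = (mdeg m + tdeg x)%N.
Proof. by rewrite /tdeg /= mdegD addnA. Qed.

Lemma tmulA m m' x : tmul m (tmul m' x) = tmul (m + m')%MM x.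
Proof. by rewrite /tmul /= addmA. Qed.

Lemma tmul0 x : tmul 0%MM x = x.
Proof. by case: x => m j; rewrite /tmul add0m. Qed.

Lemma revlex_irr x : ~ revlex_lt x x.
Proof. by case=> [[i []]|[_]]; rewrite ltnn. Qed.

Lemma revlex_trans y x z : revlex_lt x y -> revlex_lt y z -> revlex_lt x z.
Proof.
case=> [[i [xi xj]]|[xy lxy]] [[i' [yi yj]]|[yz lyz]].
- left; have [ii'|ii'|/val_inj ii'] := ltngtP i i'.
  + exists i'; split=> [|j ij]; first by rewrite xj.
    by rewrite xj ?yj // (ltn_trans ii').
  + exists i; split=> [|j ij]; first by rewrite -yj.
    by rewrite xj ?yj // (ltn_trans ii').
  + exists i; split=> [|j ij]; first by rewrite (ltn_trans _ xi) ?ii'.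
    by rewrite xj ?yj // -ii'.
- by left; exists i; rewrite -yz.
- by left; exists i'; rewrite xy.
- by right; rewrite xy yz (ltn_trans lxy).
Qed.

Lemma revlex_total x y : x != y -> revlex_lt x y \/ revlex_lt y x.
Proof.
move=> xy; have [xy1|/eqP xy1] := eqVneq x.1 y.1.
  have : x.2 != y.2.
    by apply: contra xy => /eqP xy2; rewrite -pair_eqE /pair_eq xy1 xy2 !eqxx.
  by rewrite neq_ltn => /orP[] h; [left|right]; right.
have [i0 hi0] : exists i, x.1 i != y.1 i.
  apply/existsP; apply/negbNE/negP; rewrite negb_exists => /forallP h.
  by apply: xy1; apply/mnmP => i; apply/eqP/negbNE; exact: h.
have [i hi imax] :=
  @arg_maxnP _ i0 (fun i => x.1 i != y.1 i) (fun i : 'I_n => i : nat) hi0.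
have tl (j : 'I_n) : (i < j)%N -> x.1 j = y.1 j.
  move=> ij; apply/eqP; apply/negbNE/negP => /imax; rewrite /=; lia.
move: hi; rewrite neq_ltn => /orP[] h; [right|left]; left; exists i; split=> //.
by move=> j /tl ->.
Qed.

Lemma revlex_tmul m x y : revlex_lt x y -> revlex_lt (tmul m x) (tmul m y).
Proof.
case=> [[i [xi xj]]|[xy lxy]]; [left|right].
  exists i; rewrite /= !mnmDE ltn_add2l; split=> // j /xj.
  by rewrite !mnmDE => ->.
by rewrite /tmul /= xy.
Qed.

Definition terms_of_deg (d : nat) : seq term :=
  [seq x <- [seq (bmnm p.1, p.2) |
               p <- enum {: 'X_{1..n < d.+1} * 'I_r}] | tdeg x == d].

Lemma terms_of_degP d x : (x \in terms_of_deg d) = (tdeg x == d).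
Proof.
rewrite mem_filter andb_idr // => /eqP dx.
have lt : (mdeg x.1 < d.+1)%N by rewrite -dx ltnS leq_addr.
by apply/mapP; exists (BMultinom lt, x.2); rewrite ?mem_enum //=; case: (x).
Qed.

Lemma terms_of_deg_uniq d : uniq (terms_of_deg d).
Proof.
apply: filter_uniq; rewrite map_inj_uniq ?enum_uniq //.
by case=> [a i] [b j] /= [/val_inj -> ->].
Qed.

(** Terms of a given degree are finitely many, so the reverse lexicographic
    order, which is not a well-order, allows induction inside a degree. *)
Lemma revlex_ind (A : term -> Prop) :
  (forall x, (forall y, tdeg y = tdeg x -> revlex_lt y x -> A y) -> A x) ->
  forall x, A x.
Proof.
move=> step x; pose below x := [seq y <- terms_of_deg (tdeg x) | `[<revlex_lt y x>]].
have [N] := ubnP (size (below x)); elim: N x => // N IH x /ltnSE lN.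
apply: step => y dyx yx; apply: IH; apply: leq_trans lN.
have -> : (size (below y) < size (below x))%N =
  (size (y :: below y) <= size (below x))%N by [].
apply: uniq_leq_size => [|z].
  rewrite /= filter_uniq ?terms_of_deg_uniq // andbT mem_filter negb_and.
  by apply/orP; left; apply/asboolP; exact: revlex_irr.
rewrite inE mem_filter => /orP[/eqP->|/andP[/asboolP zy]].
  by rewrite mem_filter terms_of_degP dyx eqxx andbT; apply/asboolP.
rewrite terms_of_degP dyx => dz; rewrite /below mem_filter terms_of_degP dz andbT.
by apply/asboolP; exact: revlex_trans zy yx.
Qed.

End Terms.

(** * Standard terms *)

Section TermValue.
Variables (k : comNzRingType) (n r : nat) (P : lmodType {mpoly k[n]}).
Variables (y : 'I_n -> {mpoly k[n]}) (e : 'I_r -> P).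

Definition term_val (x : term n r) : P := mmap1 y x.1 *: e x.2.

Lemma term_val_tmul m x : term_val (tmul m x) = mmap1 y m *: term_val x.
Proof.
rewrite /term_val scalerA -commr_mmap1_M // => i p; exact: mulrC.
Qed.

Lemma kspan_tmul (S S' : term n r -> Prop) m u :
  (forall x, S x -> S' (tmul m x)) -> kspan term_val S u ->
  kspan term_val S' (mmap1 y m *: u).
Proof.
move=> SS'; elim=> [|c x w Sx _ IH]; first by rewrite scaler0; left.
rewrite scalerDr scalerA mulrC -scalerA -term_val_tmul.
by apply: kspan_cons => //; exact: SS'.
Qed.

End TermValue.

Section Standard.
Variables (k : fieldType) (n r : nat) (dlt : 'I_r -> nat).
Variables (P : lmodType {mpoly k[n]}).
Variables (y : 'I_n -> {mpoly k[n]}) (e : 'I_r -> P).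
Notation val := (term_val y e).
Notation tdeg := (tdeg dlt).

Definition standard (x : term n r) : Prop :=
  ~ kspan val (fun z => tdeg z = tdeg x /\ revlex_lt z x) (val x).

(** Nonstandard terms are rewritten into smaller ones of the same degree. *)
Lemma standard_span x :
  kspan val (fun z => [/\ standard z, tdeg z = tdeg x & z = x \/ revlex_lt z x])
    (val x).
Proof.
elim/(@revlex_ind n r dlt): x => x IH.
have [sx|/contrapT nsx] := pselect (standard x).
  by apply: kspan_gen; split=> //; left.
apply: kspan_trans nsx => z [dz zx]; apply: kspan_mono (IH z dz zx).
move=> t [st dt tz]; split=> //; first by rewrite dt.
by right; case: tz => [->//|tz]; exact: revlex_trans tz zx.
Qed.

Lemma standard_down m x : standard (tmul m x) -> standard x.
Proof.
move=> smx sx; apply: smx; rewrite term_val_tmul; apply: kspan_tmul sx.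
by move=> z [dz zx]; rewrite !tdegM dz; split=> //; exact: revlex_tmul.
Qed.

(** In a linear relation the largest term that occurs is a combination of
    smaller ones. *)
Lemma standard_free_deg d : kfree val (fun x => standard x /\ tdeg x = d).
Proof.
move=> s; have [N] := ubnP (size s); elim: N s => // N IH s /ltnSE lN c us sS e0.
have [->//|s0] := eqVneq s [::].
have [x xs xmax] : exists2 x, x \in s & forall z, z \in s -> z != x -> revlex_lt z x.
  elim: s s0 {IH lN us sS e0} => // a s IHs _; have [->|s0] := eqVneq s [::].
    by exists a => [|z]; rewrite inE // => ->.
  have [x xs xmax] := IHs s0; have [->|ax] := eqVneq a x.
    exists x => [|z]; rewrite inE ?eqxx // => /orP[/eqP->|]; rewrite ?eqxx //.
    exact: xmax.
  have [ltax|ltxa] := revlex_total ax.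
    exists x => [|z]; rewrite inE ?xs ?orbT // => /orP[/eqP->//|]; exact: xmax.
  exists a => [|z]; rewrite inE ?eqxx // => /orP[/eqP->|zs _]; rewrite ?eqxx //.
  have [->//|zx] := eqVneq z x; exact: revlex_trans (xmax z zs zx) ltxa.
have [sx dx] := sS x xs.
move: e0; rewrite (bigD1_seq x) //= => e0.
have cx0 : c x = 0.
  apply/eqP/negP => /negP cx; apply: sx.
  have -> : val x = - ((c x)^-1%:MP *: \sum_(i <- s | i != x) (c i)%:MP *: val i).
    rewrite -[X in - (_ *: X)](addKr ((c x)%:MP *: val x)) e0 addr0 scalerN opprK.
    by rewrite scalerA -mpolyCM mulVf // mpolyC1 scale1r.
  apply: kspanN; apply: kspanZ; rewrite -big_filter; apply: kspan_sum_mem => z.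
  rewrite mem_filter => /andP[zx zs]; apply: kspanZ; apply: kspan_gen.
  by split; [rewrite dx; case: (sS z zs)|exact: xmax].
move: e0; rewrite cx0 mpolyC0 scale0r add0r -big_filter => e0 i is_.
have [->//|ix] := eqVneq i x.
apply: (IH [seq z <- s | z != x] _ c) => //.
- apply: leq_trans lN; rewrite size_filter -(count_predC (pred1 x) s).
  have : (0 < count (pred1 x) s)%N by rewrite -has_count has_pred1.
  by rewrite (@eq_count _ (fun z => z != x) (predC (pred1 x))) //; lia.
- exact: filter_uniq.
- by move=> z; rewrite mem_filter => /andP[_ /sS].
- by rewrite mem_filter ix.
Qed.

End Standard.

(** * Cones of terms *)

Section Cones.
Variables (n r : nat) (dlt : 'I_r -> nat) (D : nat).
Notation tdeg := (tdeg dlt).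

(** The factors of a term are read in the order of the variables, the generator
    coming first; the cut is the variable at which degree D is reached, and is n
    if it is not.  The term is then a product of a term of degree D in the
    variables up to the cut by a monomial in the variables from the cut on. *)
Definition partial_deg (x : term n r) (i : nat) : nat :=
  (dlt x.2 + \sum_(l < n | (l <= i)%N) x.1 l)%N.

Definition cut (x : term n r) : nat :=
  find (fun i => (D <= partial_deg x i)%N) (iota 0 n).

Lemma partial_deg_mono x i j : (i <= j)%N -> (partial_deg x i <= partial_deg x j)%N.
Proof.
move=> ij; rewrite leq_add2l !(big_mkcond (fun l : 'I_n => (l <= _)%N)) /=.
by apply: leq_sum => l _; case: ifP => // li; rewrite (leq_trans li).
Qed.

Lemma cut_le x : (cut x <= n)%N.
Proof. by have := find_size (fun i => (D <= partial_deg x i)%N) (iota 0 n); rewrite size_iota. Qed.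

Lemma cut_leE x i : (i < n)%N -> (cut x <= i)%N = (D <= partial_deg x i)%N.
Proof.
move=> i_n; apply/idP/idP => [ci|Di].
  have ltn : (cut x < n)%N by exact: leq_ltn_trans i_n.
  apply: leq_trans (partial_deg_mono _ ci).
  have := @nth_find _ 0%N (fun i => (D <= partial_deg x i)%N) (iota 0 n).
  by rewrite has_find size_iota => /(_ ltn); rewrite nth_iota.
rewrite leqNgt; apply/negP => /(@before_find _ 0%N).
by rewrite nth_iota // add0n Di.
Qed.

Lemma cut_eqP x c : (c < n)%N ->
  (D <= partial_deg x c)%N -> (forall i, (i < c)%N -> (partial_deg x i < D)%N) ->
  cut x = c.
Proof.
move=> cn Dc lt; apply/eqP; rewrite eqn_leq cut_leE // Dc leqNgt /=.
apply/negP => xc; have xn := ltn_trans xc cn.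
by have := lt _ xc; rewrite ltnNge -cut_leE ?leqnn.
Qed.

Lemma partial_deg_cut x : (cut x < n)%N -> (D <= partial_deg x (cut x))%N.
Proof. by move=> h; rewrite -cut_leE. Qed.

Lemma partial_deg_lt_cut x i : (i < cut x)%N -> (partial_deg x i < D)%N.
Proof.
by move=> h; rewrite ltnNge -cut_leE -?ltnNge // (leq_trans h) // cut_le.
Qed.

Lemma partial_deg_tail (x : term n r) i : (forall l : 'I_n, (i < l)%N -> x.1 l = 0%N) ->
  partial_deg x i = tdeg x.
Proof.
move=> x0; rewrite /tdeg /partial_deg addnC mdegE; congr (_ + _)%N.
rewrite big_mkcond /=; apply: eq_bigr => l _; case: leqP => // /x0 -> //.
Qed.

Lemma partial_deg_le x i : (partial_deg x i <= tdeg x)%N.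
Proof.
rewrite /tdeg addnC mdegE leq_add2l big_mkcond /=.
by apply: leq_sum => l _; case: ifP.
Qed.

Lemma tdeg_cut x : (cut x < n)%N -> (D <= tdeg x)%N.
Proof. by move/partial_deg_cut/leq_trans; apply; exact: partial_deg_le. Qed.

Lemma cut_tdeg x : cut x = n -> (0 < n)%N -> (tdeg x < D)%N.
Proof.
move=> cx n0; rewrite ltnNge; apply/negP => Dx.
have : (cut x <= n.-1)%N.
  rewrite cut_leE ?ltn_predL // partial_deg_tail // => l.
  by have := ltn_ord l; lia.
lia.
Qed.

Lemma eq_partial_deg (x z : term n r) i : x.2 = z.2 ->
  (forall l : 'I_n, (l <= i)%N -> x.1 l = z.1 l) -> partial_deg x i = partial_deg z i.
Proof. by move=> e xz; rewrite /partial_deg e; congr (_ + _)%N; apply: eq_bigr. Qed.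

(** The vertices of the cones with free variables of index at least c.  For
    c = n there is no free variable, and each term of cut n is a vertex. *)
Definition head (c : nat) (x : term n r) : Prop :=
  cut x = c /\ (c = n \/ tdeg x = D).

Definition late (c : nat) (m : 'X_{1..n}) : Prop :=
  forall l : 'I_n, (l < c)%N -> m l = 0%N.

Lemma late_n m : late n m -> m = 0%MM.
Proof. by move=> h; apply/mnmP => i; rewrite h ?mnm0E. Qed.

Lemma lateD c m m' : late c m -> late c m' -> late c (m + m')%MM.
Proof. by move=> h h' l lc; rewrite mnmDE h ?h'. Qed.

Lemma head_tail c (x : term n r) : (c < n)%N -> head c x ->
  forall l : 'I_n, (c < l)%N -> x.1 l = 0%N.
Proof.
move=> cn [cx [e|dx]] l cl; first by lia.
have : (tdeg x <= partial_deg x c)%N.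
  by rewrite dx -cx partial_deg_cut ?cx.
rewrite /tdeg /partial_deg mdegE [X in (_ <= X)%N]addnC leq_add2r.
rewrite [X in (X <= _)%N](bigID (fun l : 'I_n => (l <= c)%N)) /=.
rewrite -[X in (_ <= X)%N]addn0 leq_add2l (bigD1 l) /= -?ltnNge //; lia.
Qed.

(** If c < n, the product and the head agree before the variable c, the head has
    no variable after c, and the exponent of c is then given by the degree. *)
Lemma head_unique c (x z : term n r) m m' : head c x -> head c z -> late c m -> late c m' ->
  tmul m x = tmul m' z -> x = z.
Proof.
have := cut_le x; move=> xn hx hz lm lm'.
have cn : (c <= n)%N by case: hx => <-.
move: cn; rewrite leq_eqVlt => /orP[/eqP cn|cn].
  by rewrite cn in lm lm'; rewrite (late_n lm) (late_n lm') !tmul0.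
move=> E; have e1 := congr1 fst E; have /= e2 := congr1 snd E.
have el l : (m l + x.1 l = m' l + z.1 l)%N.
  by have := congr1 (fun w : 'X_{1..n} => w l) e1; rewrite /= !mnmDE.
have ne (l : 'I_n) : l != Ordinal cn -> x.1 l = z.1 l.
  rewrite neq_ltn => /orP[] /= h; last by rewrite !(head_tail cn) //.
  by have := el l; rewrite lm ?lm'.
have [_ [|dx]] := hx; first by lia.
have [_ [|dz]] := hz; first by lia.
have := dx; rewrite -dz /tdeg e2 => /eqP; rewrite eqn_add2r !mdegE.
rewrite (bigD1 (Ordinal cn)) //= [in X in _ == X](bigD1 (Ordinal cn)) //=.
rewrite (eq_bigr (fun l : 'I_n => z.1 l)) => [|l /ne //].
rewrite eqn_add2r => /eqP ec.
have -> : x = (x.1, x.2) by case: (x).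
have -> : z = (z.1, z.2) by case: (z).
rewrite e2; congr (_, _); apply/mnmP => l.
by have [->//|/ne] := eqVneq l (Ordinal cn).
Qed.

Hypothesis dltD : forall j, (dlt j <= D)%N.

Lemma head_tdeg c x : head c x -> (tdeg x <= D)%N.
Proof.
case=> cx [cn|-> //]; rewrite cn in cx.
have [n0|n0] := posnP n; last by rewrite ltnW // cut_tdeg.
rewrite /tdeg (_ : mdeg _ = 0%N) ?dltD // mdegE big1 // => i.
by have := ltn_ord i; rewrite {2}n0.
Qed.

(** Remove the last variable until the degree is D. *)
Lemma head_exists x : exists (m : 'X_{1..n}) (w : term n r),
  [/\ head (cut x) w, late (cut x) m & x = tmul m w].
Proof.
have [N] := ubnP (tdeg x); elim: N x => // N IH x /ltnSE lN.
have := cut_le x; rewrite leq_eqVlt => /orP[/eqP cn|cn].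
  by exists 0%MM, x; rewrite tmul0; split=> // [|l _]; [split=> //; left|rewrite mnm0E].
have := tdeg_cut cn; rewrite leq_eqVlt => /orP[/eqP cD|Dx].
  by exists 0%MM, x; rewrite tmul0; split=> // [|l _]; [split=> //; right|rewrite mnm0E].
have [i0 hi0] : exists i, x.1 i != 0%N.
  apply/existsP; apply/negbNE/negP; rewrite negb_exists => /forallP h.
  have := dltD x.2; move: Dx; rewrite /tdeg mdegE big1; first by lia.
  by move=> i _; apply/eqP/negbNE; exact: h.
have [l hl lmax] :=
  @arg_maxnP _ i0 (fun i => x.1 i != 0%N) (fun i : 'I_n => i : nat) hi0.
have tl (j : 'I_n) : (l < j)%N -> x.1 j = 0%N.
  move=> lj; apply/eqP; apply/negbNE/negP => /lmax; rewrite /=; lia.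
have cl : (cut x <= l)%N.
  by rewrite cut_leE // partial_deg_tail //; exact: ltnW.
pose z : term n r := ((x.1 - U_(l))%MM, x.2).
have xz : x = tmul U_(l)%MM z.
  by rewrite /tmul /= addmC submK ?lep1mP // -surjective_pairing.
have dxz : tdeg x = (tdeg z).+1 by rewrite xz tdegM mdeg1.
have zl (j : 'I_n) : j != l -> z.1 j = x.1 j.
  by move=> jl; rewrite mnmBE mnm1E eq_sym (negPf jl) subn0.
have cz : cut z = cut x.
  apply: cut_eqP => // [|i ic]; last first.
    rewrite (@eq_partial_deg z x) ?partial_deg_lt_cut // => j ji.
    by apply: zl; rewrite neq_ltn (leq_ltn_trans ji) // (leq_trans ic).
  move: cl; rewrite leq_eqVlt => /orP[/eqP cl|cl].
    rewrite cl partial_deg_tail ?(eqP _) //; first by lia.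
    by move=> j lj; rewrite zl ?tl // neq_ltn lj orbT.
  rewrite (@eq_partial_deg z x) ?partial_deg_cut // => j ji.
  by apply: zl; rewrite neq_ltn (leq_ltn_trans ji).
have [|m [w [hw lm zw]]] := IH z; first by lia.
rewrite cz in hw lm; exists (U_(l) + m)%MM, w; split=> //; last first.
  by rewrite -tmulA -zw.
apply: lateD => // j jl; rewrite mnm1E; case: eqP => // lj; move: jl cl; rewrite lj; lia.
Qed.

Variable W : term n r -> Prop.
Hypothesis Wdown : forall m x, W (tmul m x) -> W x.

(** The combinatorial form of the condition that y_i is a nonzerodivisor in
    large degrees modulo the later variables. *)
Definition tail_closed : Prop := forall (x : term n r) (i : 'I_n),
  W x -> (D <= tdeg x)%N -> (forall l : 'I_n, (i < l)%N -> x.1 l = 0%N) ->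
  W (tmul U_(i)%MM x).

Hypothesis Wtail : tail_closed.

(** Multiply by the variables in increasing order: at each step the term involves
    no variable after the next factor, so that tail_closed applies. *)
Lemma head_cone c w m : head c w -> W w -> late c m ->
  W (tmul m w) /\ cut (tmul m w) = c.
Proof.
move=> hw Ww lm; have cn : (c <= n)%N by case: hw => <- _; exact: cut_le.
move: cn; rewrite leq_eqVlt => /orP[/eqP cn|cn].
  by rewrite cn in lm; rewrite (late_n lm) tmul0; case: hw.
have [cw [|dw]] := hw; first by lia.
split; last first.
  apply: cut_eqP => // [|i ic].
    apply: leq_trans (_ : partial_deg w c <= _)%N.
      by rewrite -cw partial_deg_cut ?cw.
    by rewrite leq_add2l; apply: leq_sum => l _; rewrite mnmDE leq_addl.
  rewrite (@eq_partial_deg _ w) ?partial_deg_lt_cut ?cw // => l li.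
  by rewrite /= mnmDE lm // (leq_ltn_trans li).
have w0 := head_tail cn hw.
have [N] := ubnP (mdeg m); elim: N m lm => // N IH m lm /ltnSE lN.
have [m0|m0] := eqVneq m 0%MM; first by rewrite m0 tmul0.
have [i0 hi0] : exists i, m i != 0%N.
  apply/existsP; apply/negbNE/negP; rewrite negb_exists => /forallP h.
  move/eqP: m0; apply; apply/mnmP => i; rewrite mnm0E.
  by apply/eqP/negbNE; exact: h.
have [l hl lmax] :=
  @arg_maxnP _ i0 (fun i => m i != 0%N) (fun i : 'I_n => i : nat) hi0.
have tl (j : 'I_n) : (l < j)%N -> m j = 0%N.
  move=> lj; apply/eqP; apply/negbNE/negP => /lmax; rewrite /=; lia.
have cl : (c <= l)%N by rewrite leqNgt; apply/negP => /lm /eqP; exact/negP.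
have mE : m = (U_(l) + (m - U_(l)))%MM by rewrite addmC submK ?lep1mP.
rewrite mE -tmulA; apply: Wtail.
- apply: IH => [j jc|]; first by rewrite mnmBE lm.
  by move: lN; rewrite {1}mE mdegD mdeg1.
- by rewrite tdegM dw leq_addl.
by move=> j lj /=; rewrite mnmDE mnmBE tl // w0 // (leq_ltn_trans cl).
Qed.

Lemma cone_closed m x : W x -> late (cut x) m ->
  W (tmul m x) /\ cut (tmul m x) = cut x.
Proof.
move=> Wx lm; have [m' [w [hw lm' xw]]] := head_exists x.
have Ww : W w by apply: (Wdown (m := m')); rewrite -xw.
by have := head_cone hw Ww (lateD lm lm'); rewrite -tmulA -xw.
Qed.

End Cones.

(** * From cones of terms to a filtered Stanley decomposition *)

Lemma kfree_comp (k : comNzRingType) (n : nat) (P : lmodType {mpoly k[n]})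
    (I J : eqType) (f : I -> P) (h : J -> I) (S : I -> Prop) (S' : J -> Prop) :
  (forall j, S' j -> S (h j)) ->
  (forall j j', S' j -> S' j' -> h j = h j' -> j = j') ->
  kfree f S -> kfree (f \o h) S'.
Proof.
move=> hS hI fr s c us sS' e0 j js.
have inj : {in s &, injective h} by move=> a b /sS' Sa /sS' Sb; exact: hI.
pose c' i := \sum_(j <- s | h j == i) c j.
have c'h a : a \in s -> c' (h a) = c a.
  move=> as_; rewrite /c' -big_filter (bigD1_seq a) ?filter_uniq ?mem_filter ?eqxx //=.
  rewrite big_filter_cond big_seq_cond big1 ?addr0 // => b /and3P[bs /eqP hb].
  by rewrite (inj _ _ bs as_ hb) eqxx.
rewrite -c'h //; apply: (fr [seq h j | j <- s]); last exact: map_f.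
- by rewrite map_inj_in_uniq.
- by move=> i /mapP[a /sS' Sa ->]; exact: hS.
by rewrite big_map big_seq -[RHS]e0 [RHS]big_seq; apply: eq_bigr => a /c'h ->.
Qed.

Section Decomposition.
Variables (k : fieldType) (n r : nat) (P : lmodType {mpoly k[n]}).
Variables (Pd : int -> set P) (base : int) (dlt : 'I_r -> nat) (D : nat).
Variables (g : 'M[k]_n) (e : 'I_r -> P).
Notation val := (term_val (tnth (new_coord g)) e).
Notation tdeg := (tdeg dlt).
Notation cut := (cut dlt D).
Notation head := (head dlt D).
Hypothesis dltD : forall j, (dlt j <= D)%N.
Hypothesis Pd0 : forall d, Pd d 0.
Hypothesis PdD : forall d u v, Pd d u -> Pd d v -> Pd d (u + v).
Hypothesis Pd_val : forall c x, Pd (base + (tdeg x)%:Z) (c%:MP *: val x).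
Variable W : term n r -> Prop.
Hypothesis Wdown : forall m x, W (tmul m x) -> W x.
Hypothesis Wtail : tail_closed dlt D W.
Hypothesis Wfree : kfree val W.
Hypothesis Wspan : forall u, kspan val W u.

Lemma comp_coord_scale (p : {mpoly k[n]}) x :
  (p \mPo new_coord g) *: val x = \sum_(m <- msupp p) (p@_m)%:MP *: val (tmul m x).
Proof.
rewrite /comp_mpoly /mmap scaler_suml; apply: eq_bigr => m _.
by rewrite term_val_tmul -scalerA.
Qed.

(** The ring of the i-th summand has the variables of index at least n - i. *)
Definition cone_part (i : 'I_n.+1) : set P :=
  kspan val (fun x => W x /\ cut x = (n - i)%N).

Lemma cone_part_graded (i : 'I_n.+1) :
  is_graded_submod Pd (last_coord_ring g i) (cone_part i).
Proof.
split=> [|u v||u Nu]; [by left|exact: kspanD| |].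
  move=> _ u [p pR ->]; elim=> [|c x w [Wx cx] _ IH]; first by rewrite scaler0; left.
  rewrite scalerDr; apply: kspanD => //; rewrite scalerA mulrC -scalerA.
  apply: kspanZ; rewrite comp_coord_scale; apply: kspan_sum_mem => m /pR pm.
  apply: kspanZ; apply: kspan_gen; rewrite -cx; apply: cone_closed => //.
  by rewrite /late cx.
have [s [c [us sS ->]]] := kspanP Nu.
pose dg (x : term n r) : int := base + (tdeg x)%:Z.
exists (undup (map dg s)), (fun d => \sum_(x <- s | dg x == d) (c x)%:MP *: val x).
split; first exact: undup_uniq.
  move=> d; split.
    apply: (big_ind (Pd d)) => //; first exact: PdD.
    by move=> x /eqP <-; exact: Pd_val.
  rewrite -big_filter; apply: kspan_sum_mem => x; rewrite mem_filter => /andP[_ /sS].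
  by move=> Sx; apply: kspanZ; exact: kspan_gen.
by rewrite sum_undup_fibers.
Qed.

Definition heads (c : nat) : seq (term n r) :=
  [seq x <- [seq x | d <- iota 0 D.+1, x <- terms_of_deg n dlt d] |
     `[< head c x /\ W x >]].

Lemma headsP c x : (x \in heads c) <-> head c x /\ W x.
Proof.
rewrite mem_filter; split=> [/andP[/asboolP]//|[hx Wx]].
apply/andP; split; first exact/asboolP.
apply/allpairsPdep; exists (tdeg x), x; split=> //; last by rewrite terms_of_degP.
by rewrite mem_iota add0n ltnS (head_tdeg dltD hx).
Qed.

Lemma heads_uniq c : uniq (heads c).
Proof.
apply: filter_uniq; apply: allpairs_uniq_dep => [|d _|]; first exact: iota_uniq.
  exact: terms_of_deg_uniq.
move=> [d x] [d' x'] /allpairsPdep[? [? [_ h [-> ->]]]] /allpairsPdep[? [? [_ h' [-> ->]]]].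
by move: h h'; rewrite !terms_of_degP /= => /eqP <- /eqP <- ->.
Qed.

Lemma cone_part_basis (i : 'I_n.+1) :
  has_homog_basis Pd (last_coord_ring g i) (cone_part i).
Proof.
set c := (n - i)%N; pose s := in_tuple (heads c).
have sP j : head c (tnth s j) /\ W (tnth s j) by apply/headsP; exact: mem_tnth.
have RE (q : {mpoly k[n]}) : last_coord_ring g i q <->
    exists2 p : {mpoly k[n]}, (forall m, m \in msupp p -> late c m) & q = p \mPo new_coord g.
  by [].
exists (size (heads c)), (fun j => val (tnth s j)); split.
- move=> j; have [hj Wj] := sP j; split; first by apply: kspan_gen; case: hj.
  exists (base + (tdeg (tnth s j))%:Z).
  by rewrite -[val _]scale1r -mpolyC1; exact: Pd_val.
- move=> u; elim=> {u} [|a x u [Wx cx] _ [q [qR ->]]].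
    exists (fun=> 0); split; last by rewrite big1 // => j _; rewrite scale0r.
    by move=> j; apply/RE; exists 0; rewrite ?comp_mpoly0 // => m; rewrite msupp0.
  have [m [w [hw lm xw]]] := head_exists dltD x.
  rewrite cx in hw lm.
  have Ww : W w by apply: (Wdown (m := m)); rewrite -xw.
  have /tnthP[j wj] : w \in s by apply/headsP.
  exists (fun l => if l == j then (a *: 'X_[m]) \mPo new_coord g + q l else q l).
  split=> [l|].
    case: eqP => // _; have [p pR ->] := qR l; apply/RE.
    exists (a *: 'X_[m] + p); last by rewrite comp_mpolyD.
    move=> m' /msuppD_le; rewrite mem_cat => /orP[/msuppZ_le|/pR//].
    by rewrite msuppX inE => /eqP ->.
  rewrite (bigD1 j) //= [in RHS](bigD1 j) //= eqxx scalerDl -!addrA; congr (_ + _).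
    rewrite comp_mpolyZ -mul_mpolyC -scalerA xw term_val_tmul wj comp_mpolyX.
    by [].
  by congr (_ + _); apply: eq_bigr => l /negPf ->.
- move=> q qR e0.
  have /choice[p pP] : forall j, exists p : {mpoly k[n]},
      (forall m, m \in msupp p -> late c m) /\ q j = p \mPo new_coord g.
    by move=> j; have [p lp ->] := qR j; exists p.
  suff p0 j : p j = 0 by move=> j; rewrite (pP j).2 p0 comp_mpoly0.
  pose h (jm : 'I_(size (heads c)) * 'X_{1..n}) := tmul jm.2 (tnth s jm.1).
  pose t := [seq (l, m) | l <- enum 'I_(size (heads c)), m <- msupp (p l)].
  have tP jm : jm \in t -> late c jm.2.
    by case/allpairsPdep=> l [m [_ mp ->]]; exact: (pP l).1 mp.
  have := @kfree_comp _ _ _ _ _ val h W (fun jm => late c jm.2) _ _ Wfree.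
  move=> /(_ _ _ t (fun jm => (p jm.1)@_jm.2) _ tP) fr.
  apply/mpolyP => m; rewrite mcoeff0; have [mp|/memN_msupp_eq0 //] := boolP (m \in msupp (p j)).
  apply: (fr _ _ _ _ (j, m)).
  + by move=> [l a] /= la; have [hl Wl] := sP l; case: (head_cone Wtail hl Wl la).
  + move=> [l a] [l' a'] /= la la' E.
    have ll' : l = l'.
      have := head_unique (sP l).1 (sP l').1 la la' E.
      by apply: (tuple_uniqP _ _); exact: heads_uniq.
    rewrite ll' in E *; congr (_, _).
    by have /= /addIm := congr1 fst E.
  + apply: allpairs_uniq_dep; first exact: enum_uniq.
      by move=> l _; exact: msupp_uniq.
    by move=> [l a] [l' a'] _ _ /= [-> ->].
  + rewrite /t big_allpairs_dep /= -[RHS]e0 big_enum /=; apply: eq_bigr => l _.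
    by rewrite (pP l).2 comp_coord_scale.
  + by apply/allpairsPdep; exists j, m; rewrite mem_enum.
Qed.

(** The cut of a basis term determines the summand that contains it. *)
Lemma cone_decomposition :
  exists N : 'I_n.+1 -> set P, filtered_Stanley_decomposition Pd g N.
Proof.
exists cone_part; split=> [i|u|v vN v0 i].
- by split; [exact: cone_part_graded|exact: cone_part_basis].
- elim: (Wspan u) => [|c x w Wx _ [v [vN ->]]].
    by exists (fun=> 0); split=> [i|]; [exact: kspan0|rewrite big1].
  have ci : (n - cut x < n.+1)%N by rewrite ltnS leq_subr.
  pose i := Ordinal ci.
  exists (fun l => if l == i then c%:MP *: val x + v l else v l); split=> [l|].
    case: eqP => // ->; apply: kspan_cons; last exact: vN.
    by split=> //=; rewrite subKn // cut_le.
  rewrite (bigD1 i) //= [in RHS](bigD1 i) //= eqxx -addrA; congr (_ + (_ + _)).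
  by apply: eq_bigr => l /negPf ->.
apply: (@kfree_disjoint _ _ _ _ val (fun x => W x /\ cut x = (n - i)%N)
          (fun x => W x /\ cut x <> (n - i)%N)).
- by move=> x [_ cx] [_].
- by apply: kfree_mono Wfree => x [] [].
- exact: vN.
move: v0; rewrite (bigD1 i) //= => /eqP; rewrite addr_eq0 => /eqP ->.
apply: kspanN; apply: kspan_sum => l li; apply: kspan_mono (vN l) => x [Wx cx].
split=> //; rewrite cx; have := ltn_ord i; have := ltn_ord l.
by move: li; rewrite -val_eqE /=; lia.
Qed.

End Decomposition.

(** * Extension of scalars *)

Section FreegSum.
Variables (B : choiceType) (R : comNzRingType) (V : zmodType).

(** The additive map out of formal sums with prescribed values h b c on the
    elements c b; all the maps out of an extension of scalars arise so. *)
Definition fsum (h : B -> R -> V) (v : {freeg B / R}) : V :=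
  \sum_(b <- dom v) h b (coeff b v).

Variable h : B -> {additive R -> V}.

Lemma fsum_sub (s : seq B) v : uniq s -> {subset dom v <= s} ->
  fsum h v = \sum_(b <- s) h b (coeff b v).
Proof.
move=> us ds; rewrite /fsum [RHS](bigID (fun b => b \in dom v)) /=.
rewrite [X in _ + X]big1 ?addr0 => [|b /coeff_outdom ->]; last exact: raddf0.
rewrite -[RHS]big_filter; apply: perm_big; apply: uniq_perm.
- exact: uniq_dom.
- exact: filter_uniq.
by move=> b; rewrite mem_filter; case: (boolP (b \in dom v)) => // /ds ->.
Qed.

Lemma fsumB : {morph fsum h : u v / u - v}.
Proof.
move=> u v; pose s := undup (dom u ++ dom v).
have us : uniq s by exact: undup_uniq.
rewrite !(@fsum_sub s) // => [|b|b|b /domB]; rewrite ?mem_undup //; last 2 first.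
- by rewrite mem_cat => ->; rewrite orbT.
- by rewrite mem_cat => ->.
by rewrite -sumrB; apply: eq_bigr => b _; rewrite coeffB raddfB.
Qed.

Lemma fsumU c b : fsum h << c *g b >> = h b c.
Proof.
rewrite (@fsum_sub [:: b]) // => [|b'].
  by rewrite big_seq1 coeffU eqxx mulr1.
rewrite mem_dom coeffU inE; apply: contraR => /negPf bb.
by rewrite [b == _]eq_sym bb mulr0.
Qed.

End FreegSum.

Lemma morph_sub_add (U V : zmodType) (q : U -> V) :
  {morph q : u v / u - v} -> {morph q : u v / u + v} /\ q 0 = 0.
Proof.
move=> qB; have q0 : q 0 = 0 by have := qB 0 0; rewrite !subrr.
split=> // a b; have := qB a (- b); rewrite opprK => ->.
by have := qB 0 b; rewrite q0 !sub0r => ->; rewrite opprK.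
Qed.

Lemma freeg_additive_ext (B : choiceType) (R : comNzRingType) (V : zmodType)
    (f f' : {freeg B / R} -> V) :
  {morph f : u v / u - v} -> {morph f' : u v / u - v} ->
  (forall c b, f << c *g b >> = f' << c *g b >>) -> f =1 f'.
Proof.
move=> fB f'B ff' v.
have [fD f0] := morph_sub_add fB; have [f'D f'0] := morph_sub_add f'B.
rewrite -(freeg_sumE v) (big_morph f fD f0) (big_morph f' f'D f'0).
by apply: eq_bigr => b _.
Qed.

Lemma mpoly_additive_ext (n : nat) (R : comNzRingType) (V : zmodType)
    (f f' : {mpoly R[n]} -> V) :
  {morph f : u v / u - v} -> {morph f' : u v / u - v} ->
  (forall c m, f (c *: 'X_[m]) = f' (c *: 'X_[m])) -> f =1 f'.
Proof.
move=> fB f'B ff' p.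
have [fD f0] := morph_sub_add fB; have [f'D f'0] := morph_sub_add f'B.
rewrite (mpolyE p) (big_morph f fD f0) (big_morph f' f'D f'0).
by apply: eq_bigr => b _.
Qed.

Record constant_basis (K : fieldType) (n : nat) (M : lmodType {mpoly K[n]}) :=
  ConstantBasis {
    cb_index : choiceType;
    cb_vec : cb_index -> M;
    cb_free : kfree cb_vec (fun=> True);
    cb_span : forall u, kspan cb_vec (fun=> True) u }.

Section Coordinates.
Variables (K : fieldType) (n : nat) (M : lmodType {mpoly K[n]}).
Variable E : constant_basis M.
Notation B := (cb_index E).
Notation beta := (@cb_vec _ _ _ E).

Definition scale_const (u : M) (c : K) : M := c%:MP *: u.
Lemma scale_const_additive u : additive (scale_const u).
Proof. by move=> a b; rewrite /scale_const mpolyCB scalerBl. Qed.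
HB.instance Definition _ u :=
  GRing.isAdditive.Build K M (scale_const u) (scale_const_additive u).

Definition combine (v : {freeg B / K}) : M := fsum (fun b => scale_const (beta b)) v.

Lemma combineB : {morph combine : u v / u - v}.
Proof. exact: fsumB. Qed.

Lemma combine0 : combine 0 = 0.
Proof. by have := combineB 0 0; rewrite !subrr. Qed.

Lemma combineU c b : combine << c *g b >> = c%:MP *: beta b.
Proof. exact: fsumU. Qed.

Lemma combine_inj : injective combine.
Proof.
move=> u v uv; apply/eqP; rewrite -subr_eq0; set w := u - v.
have : combine w = 0 by rewrite combineB uv subrr.
move=> /(@cb_free _ _ _ E (dom w) (fun b => coeff b w) (uniq_dom w)) h.
rewrite -dom_eq0; case dw : (dom w) => [//|b s].
have bw : b \in dom w by rewrite dw mem_head.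
by have := bw; rewrite mem_dom h ?eqxx.
Qed.

Lemma combine_surj u : exists v, combine v = u.
Proof.
elim: (cb_span E u) => [|c b w _ _ [v <-]].
  by exists 0; exact: combine0.
exists (<< c *g b >> - (0 - v)); rewrite !combineB combine0 combineU sub0r.
by rewrite opprK.
Qed.

Definition coord (u : M) : {freeg B / K} := projT1 (cid (combine_surj u)).

Lemma coordK u : combine (coord u) = u.
Proof. by rewrite /coord; case: cid. Qed.

Lemma coord_additive : additive coord.
Proof. by move=> u v; apply: combine_inj; rewrite combineB !coordK. Qed.
HB.instance Definition _ := GRing.isAdditive.Build M {freeg B / K} coord coord_additive.

Lemma combineZ c v : combine (c *: v) = c%:MP *: combine v.
Proof.
apply: (@freeg_additive_ext _ _ _ (fun v => combine (c *: v))
  (fun v => c%:MP *: combine v)) => [a b|a b|a b].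
- by rewrite scalerBr combineB.
- by rewrite combineB scalerBr.
have -> : c *: << a *g b >> = << c * a *g b >> :> {freeg B / K}.
  by apply/eqP/freeg_eqP => x; rewrite coeffZ !coeffU mulrA.
by rewrite !combineU mpolyCM scalerA.
Qed.

Lemma coordZ c u : coord (c%:MP *: u) = c *: coord u.
Proof. by apply: combine_inj; rewrite combineZ !coordK. Qed.

Lemma coord_vec b : coord (beta b) = << b >>.
Proof. by apply: combine_inj; rewrite coordK combineU mpolyC1 scale1r. Qed.

End Coordinates.

Section ChangeCoefficients.
Variables (B : choiceType) (R R' : comNzRingType).

Section Map.
Variable f : {additive R -> R'}.

Definition gen_at (b : B) (c : R) : {freeg B / R'} := << f c *g b >>.
Lemma gen_at_additive b : additive (gen_at b).
Proof. by move=> a c; rewrite /gen_at raddfB freegUB. Qed.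
HB.instance Definition _ b :=
  GRing.isAdditive.Build R {freeg B / R'} (gen_at b) (gen_at_additive b).

Definition freeg_map (v : {freeg B / R}) : {freeg B / R'} := fsum gen_at v.

Lemma freeg_mapB : {morph freeg_map : u v / u - v}.
Proof. exact: fsumB. Qed.
HB.instance Definition _ :=
  GRing.isAdditive.Build {freeg B / R} {freeg B / R'} freeg_map freeg_mapB.

Lemma freeg_mapU c b : freeg_map << c *g b >> = << f c *g b >>.
Proof. exact: fsumU. Qed.

Lemma coeff_freeg_map v b : coeff b (freeg_map v) = f (coeff b v).
Proof.
apply: (@freeg_additive_ext _ _ _ (fun v => coeff b (freeg_map v))
  (fun v => f (coeff b v))) => [u w|u w|c b'].
- by rewrite !raddfB.
- by rewrite !raddfB.
rewrite freeg_mapU !coeffU; case: (b' == b); rewrite ?mulr1 // !mulr0 raddf0 //.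
Qed.

End Map.

Lemma freeg_scaleU (c d : R) b : c *: << d *g b >> = << c * d *g b >> :> {freeg B / R}.
Proof. by apply/eqP/freeg_eqP => x; rewrite coeffZ !coeffU mulrA. Qed.

End ChangeCoefficients.

Lemma freeg_map_scale (B : choiceType) (K R R' : comNzRingType)
    (phi : {rmorphism K -> R}) (phi' : {rmorphism K -> R'})
    (f : {additive R -> R'}) (r : R) (w : {freeg B / K}) :
  (forall c, f (r * phi c) = f r * phi' c) ->
  freeg_map f (r *: freeg_map phi w) = f r *: freeg_map phi' w.
Proof.
move=> frc; apply/eqP/freeg_eqP => b.
by rewrite coeff_freeg_map !coeffZ !coeff_freeg_map frc.
Qed.

Section Extension.
Variables (K : fieldType) (n : nat) (M : lmodType {mpoly K[n]}).
Variable E : constant_basis M.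
Notation B := (cb_index E).
Notation beta := (@cb_vec _ _ _ E).

Section Over.
Variables (R : comNzRingType) (phi : {rmorphism K -> R}).

(** The tensor product of M and R over K, constructed as the free R-module on a
    basis of M over K.  The map phi is an argument because the action of the
    variables, given by structure constants in K, depends on it. *)
Definition base_ext (_ : {rmorphism K -> R}) : Type := {freeg B / R}.
HB.instance Definition _ := GRing.Zmodule.copy (base_ext phi) {freeg B / R}.
Notation bext := (base_ext phi).

Definition rscale (c : R) (v : bext) : bext := (c *: (v : {freeg B / R})).

Lemma rscale_is_additive c : additive (rscale c).
Proof. by move=> u v; rewrite /rscale scalerBr. Qed.
HB.instance Definition _ c :=
  GRing.isAdditive.Build bext bext (rscale c) (rscale_is_additive c).

Lemma rscaleBl v : {morph rscale^~ v : c d / c - d}.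
Proof. by move=> c d; rewrite /rscale scalerBl. Qed.

Lemma rscaleA c d v : rscale c (rscale d v) = rscale (c * d) v.
Proof. exact: scalerA. Qed.

Lemma rscale1 v : rscale 1 v = v.
Proof. exact: scale1r. Qed.

Definition ext_emb (u : M) : bext := freeg_map phi (coord E u).

Lemma ext_emb_additive : additive ext_emb.
Proof. by move=> u v; rewrite /ext_emb !raddfB. Qed.
HB.instance Definition _ := GRing.isAdditive.Build M bext ext_emb ext_emb_additive.

Lemma ext_embZ c u : ext_emb (c%:MP *: u) = rscale (phi c) (ext_emb u).
Proof.
rewrite /ext_emb /rscale coordZ; apply/eqP/freeg_eqP => b.
by rewrite coeffZ !coeff_freeg_map coeffZ /=; exact: rmorphM.
Qed.

Lemma ext_emb_vec b : ext_emb (beta b) = << b >>.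
Proof. by rewrite /ext_emb coord_vec freeg_mapU /= rmorph1. Qed.

Lemma bextU c b : << c *g b >> = rscale c (ext_emb (beta b)) :> bext.
Proof. by rewrite ext_emb_vec /rscale freeg_scaleU mulr1. Qed.

Lemma bext_additive_ext (V : zmodType) (f f' : bext -> V) :
  {morph f : u v / u - v} -> {morph f' : u v / u - v} ->
  (forall c b, f (rscale c (ext_emb (beta b))) = f' (rscale c (ext_emb (beta b)))) ->
  f =1 f'.
Proof.
move=> fB f'B ff'; apply: (@freeg_additive_ext B R V f f' fB f'B) => c b.
by have := ff' c b; rewrite -bextU.
Qed.

(** Polynomials over K act R-linearly by their action on the basis; polynomials
    over R act through their monomials. *)
Definition op_at (p : {mpoly K[n]}) (b : B) (c : R) : bext :=
  rscale c (ext_emb (p *: beta b)).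
Lemma op_at_additive p b : additive (op_at p b).
Proof. by move=> c d; rewrite /op_at rscaleBl. Qed.
HB.instance Definition _ p b :=
  GRing.isAdditive.Build R bext (op_at p b) (op_at_additive p b).

Definition ext_op (p : {mpoly K[n]}) (v : bext) : bext := fsum (op_at p) v.

Lemma ext_op_is_additive p : additive (ext_op p).
Proof. exact: fsumB. Qed.
HB.instance Definition _ p :=
  GRing.isAdditive.Build bext bext (ext_op p) (ext_op_is_additive p).

Lemma ext_op_vec p c b : ext_op p (rscale c (ext_emb (beta b))) =
  rscale c (ext_emb (p *: beta b)).
Proof. by rewrite -bextU; exact: fsumU. Qed.

Lemma ext_op_rscale p c v : ext_op p (rscale c v) = rscale c (ext_op p v).
Proof.
apply: (@bext_additive_ext _ (fun v => ext_op p (rscale c v))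
  (fun v => rscale c (ext_op p v))) => [u w|u w|d b]; rewrite ?raddfB //.
by rewrite rscaleA !ext_op_vec rscaleA.
Qed.

Lemma module_additive_ext (V : zmodType) (f f' : M -> V) :
  {morph f : u v / u - v} -> {morph f' : u v / u - v} ->
  (forall c b, f (c%:MP *: beta b) = f' (c%:MP *: beta b)) -> f =1 f'.
Proof.
move=> fB f'B ff' u; rewrite -(coordK E u).
apply: (@freeg_additive_ext _ _ _ (f \o combine (E := E)) (f' \o combine (E := E))).
- by move=> a b /=; rewrite combineB fB.
- by move=> a b /=; rewrite combineB f'B.
by move=> c b /=; rewrite combineU.
Qed.

Lemma ext_op_emb p u : ext_op p (ext_emb u) = ext_emb (p *: u).
Proof.
apply: (@module_additive_ext _ (fun u => ext_op p (ext_emb u))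
  (fun u => ext_emb (p *: u))) => [a b|a b|c b].
- by rewrite !raddfB.
- by rewrite scalerBr raddfB.
by rewrite ext_embZ ext_op_vec -ext_embZ scalerA mulrC -scalerA.
Qed.

Lemma ext_opM p q v : ext_op p (ext_op q v) = ext_op (p * q) v.
Proof.
apply: (@bext_additive_ext _ (fun v => ext_op p (ext_op q v)) (ext_op (p * q)))
  => [u w|u w|c b]; rewrite ?raddfB //.
by rewrite !ext_op_vec ext_op_rscale ext_op_emb scalerA.
Qed.

Lemma ext_op1 v : ext_op 1 v = v.
Proof.
apply: (@bext_additive_ext _ (ext_op 1) id) => [u w|u w|c b]; rewrite ?raddfB //.
by rewrite ext_op_vec scale1r.
Qed.

Lemma ext_opBl v : {morph ext_op^~ v : p q / p - q}.
Proof.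
move=> p q; apply: (@bext_additive_ext _ (ext_op (p - q))
  (fun v => ext_op p v - ext_op q v)) => [u w|u w|c b].
- exact: raddfB.
- by rewrite !ext_op_is_additive !opprD !opprK addrACA.
by rewrite !ext_op_vec scalerBl !raddfB.
Qed.

Lemma ext_opC c v : ext_op c%:MP v = rscale (phi c) v.
Proof.
apply: (@bext_additive_ext _ (ext_op c%:MP) (rscale (phi c)))
  => [u w|u w|d b]; rewrite ?raddfB //.
by rewrite ext_op_vec ext_embZ !rscaleA mulrC.
Qed.

Definition scale_at (v : bext) (m : 'X_{1..n}) (c : R) : bext :=
  rscale c (ext_op 'X_[m] v).
Lemma scale_at_additive v m : additive (scale_at v m).
Proof. by move=> c d; rewrite /scale_at rscaleBl. Qed.
HB.instance Definition _ v m :=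
  GRing.isAdditive.Build R bext (scale_at v m) (scale_at_additive v m).

Definition ext_scale (p : {mpoly R[n]}) (v : bext) : bext :=
  fsum (scale_at v) (mpoly_val p).

Lemma ext_scaleBl v : {morph ext_scale^~ v : p q / p - q}.
Proof. by move=> p q; exact: fsumB. Qed.

Lemma ext_scale_term c m v :
  ext_scale (c *: 'X_[m]) v = rscale c (ext_op 'X_[m] v).
Proof.
rewrite /ext_scale; have -> : mpoly_val (c *: 'X_[R, m]) = << c *g m >>.
  by rewrite -MPolyU.
exact: fsumU.
Qed.

Lemma ext_scale_additive p : {morph ext_scale p : u v / u - v}.
Proof.
move=> u v; apply: (@mpoly_additive_ext _ _ _ (ext_scale^~ (u - v))
  (fun p => ext_scale p u - ext_scale p v)) => [a b|a b|c m].
- exact: ext_scaleBl.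
- by rewrite !ext_scaleBl !opprD !opprK addrACA.
by rewrite !ext_scale_term !raddfB.
Qed.

Lemma ext_scale_mul p q v : ext_scale p (ext_scale q v) = ext_scale (p * q) v.
Proof.
apply: (@mpoly_additive_ext _ _ _ (fun p => ext_scale p (ext_scale q v))
  (fun p => ext_scale (p * q) v)) => [a b|a b|c m].
- exact: ext_scaleBl.
- by rewrite mulrBl ext_scaleBl.
apply: (@mpoly_additive_ext _ _ _ (fun q => ext_scale _ (ext_scale q v))
  (fun q => ext_scale (_ * q) v)) => [a b|a b|d m'].
- by rewrite ext_scaleBl ext_scale_additive.
- by rewrite mulrBr ext_scaleBl.
rewrite -scalerAl -scalerAr -mpolyXD scalerA !ext_scale_term.
by rewrite ext_op_rscale rscaleA ext_opM -mpolyXD.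
Qed.

Lemma ext_scale1 v : ext_scale 1 v = v.
Proof.
by rewrite -mpolyX0 -[X in ext_scale X _]scale1r ext_scale_term rscale1 mpolyX0 ext_op1.
Qed.

Lemma ext_scaleDr : right_distributive ext_scale +%R.
Proof.
move=> p u v; have := ext_scale_additive p u (- v); rewrite opprK => ->.
have := ext_scale_additive p 0 v; rewrite sub0r => ->.
have := ext_scale_additive p 0 0; rewrite !subrr => ->.
by rewrite sub0r opprK.
Qed.

Lemma ext_scaleDl v : {morph ext_scale^~ v : p q / p + q}.
Proof.
move=> p q; have /= := ext_scaleBl v p (- q); rewrite opprK => ->.
have /= := ext_scaleBl v 0 q; rewrite sub0r => ->.
have /= := ext_scaleBl v 0 0; rewrite !subrr => ->.
by rewrite sub0r opprK.
Qed.

HB.instance Definition _ := GRing.Zmodule_isLmodule.Build {mpoly R[n]} bext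
  ext_scale_mul ext_scale1 ext_scaleDr ext_scaleDl.

Lemma bext_scaleX c m (v : bext) : (c *: 'X_[m]) *: v = rscale c (ext_op 'X_[m] v).
Proof. exact: ext_scale_term. Qed.

Lemma bext_scaleC c (v : bext) : c%:MP *: v = rscale c v.
Proof.
have -> : c%:MP_[n] = c *: 'X_[0%MM] by rewrite mpolyX0 -alg_mpolyC.
by rewrite bext_scaleX mpolyX0 ext_op1.
Qed.

Lemma bext_scale_map p (v : bext) : map_mpoly phi p *: v = ext_op p v.
Proof.
apply: (@mpoly_additive_ext _ _ _ (fun p => map_mpoly phi p *: v) (ext_op^~ v)) => [a b|a b|c m].
- by rewrite raddfB scalerBl.
- exact: ext_opBl.
rewrite map_mpolyZ map_mpolyX bext_scaleX.
by rewrite -mul_mpolyC -ext_opM ext_opC.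
Qed.

Lemma ext_emb_scale p u : ext_emb (p *: u) = map_mpoly phi p *: ext_emb u.
Proof. by rewrite bext_scale_map ext_op_emb. Qed.

End Over.
End Extension.

Section FunctorialExtension.
Variables (K : fieldType) (n : nat) (M : lmodType {mpoly K[n]}).
Variable E : constant_basis M.
Notation beta := (@cb_vec _ _ _ E).
Variables (R R' : comNzRingType) (phi : {rmorphism K -> R}) (phi' : {rmorphism K -> R'}).

(** An extension is functorial in R for K-linear maps, not only for ring maps;
    this is used below for the maps that extract coefficients. *)
Section Linear.
Variable f : {additive R -> R'}.
Hypothesis f_lin : forall r c, f (r * phi c) = f r * phi' c.

Definition ext_map (v : base_ext E phi) : base_ext E phi' := freeg_map f v.

Lemma ext_mapB : {morph ext_map : u v / u - v}.
Proof. exact: freeg_mapB. Qed.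
HB.instance Definition _ :=
  GRing.isAdditive.Build (base_ext E phi) (base_ext E phi') ext_map ext_mapB.

Lemma ext_map_rscale_emb r u :
  ext_map (rscale r (ext_emb E phi u)) = rscale (f r) (ext_emb E phi' u).
Proof. by apply: freeg_map_scale => c; exact: f_lin. Qed.

Lemma ext_map_op p v : ext_map (ext_op p v) = ext_op p (ext_map v).
Proof.
apply: (@bext_additive_ext _ _ _ _ _ _ _ (fun v => ext_map (ext_op p v))
  (fun v => ext_op p (ext_map v))) => [a b|a b|c b].
- by rewrite !raddfB.
- by rewrite !raddfB.
by rewrite ext_op_vec !ext_map_rscale_emb ext_op_vec.
Qed.

Lemma ext_map_X m v : ext_map ('X_[m] *: v) = 'X_[m] *: ext_map v.
Proof.
by rewrite -(map_mpolyX phi) bext_scale_map ext_map_op -bext_scale_map map_mpolyX.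
Qed.

Lemma ext_map_inj : injective f -> injective ext_map.
Proof.
move=> fI u v uv; apply/eqP/freeg_eqP => b; apply: fI.
have := congr1 (fun w : {freeg (cb_index E) / R'} => coeff b w) uv.
by rewrite /ext_map /= !coeff_freeg_map.
Qed.

End Linear.

Section Ring.
Variable psi : {rmorphism R -> R'}.
Hypothesis psi_phi : forall c, psi (phi c) = phi' c.

Lemma ext_map_lin r c : psi (r * phi c) = psi r * phi' c.
Proof. by rewrite rmorphM psi_phi. Qed.

Lemma ext_map_rscale c v : ext_map psi (rscale c v) = rscale (psi c) (ext_map psi v).
Proof.
apply: (@bext_additive_ext _ _ _ _ _ _ _ (fun v => ext_map psi (rscale c v))
  (fun v => rscale (psi c) (ext_map psi v))) => [a b|a b|d b].
- by rewrite !raddfB.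
- by rewrite !raddfB.
by rewrite rscaleA !(ext_map_rscale_emb ext_map_lin) rscaleA -rmorphM.
Qed.

Lemma ext_map_scale p v : ext_map psi (p *: v) = map_mpoly psi p *: ext_map psi v.
Proof.
apply: (@mpoly_additive_ext _ _ _ (fun p => ext_map psi (p *: v))
  (fun p => map_mpoly psi p *: ext_map psi v)) => [a b|a b|c m].
- by rewrite scalerBl raddfB.
- by rewrite raddfB scalerBl.
rewrite map_mpolyZ map_mpolyX !bext_scaleX ext_map_rscale.
by rewrite (ext_map_op ext_map_lin).
Qed.

Lemma ext_map_emb u : ext_map psi (ext_emb E phi u) = ext_emb E phi' u.
Proof.
by rewrite -[X in ext_map _ X]rscale1 (ext_map_rscale_emb ext_map_lin) /= rmorph1 rscale1.
Qed.

End Ring.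

Lemma kspan_emb (I : Type) (f : I -> M) (S : I -> Prop) u :
  kspan f S u -> kspan (fun i => ext_emb E phi (f i)) S (ext_emb E phi u).
Proof.
elim=> [|c i w Si _ IH]; first by rewrite raddf0; left.
by rewrite raddfD /= ext_embZ -bext_scaleC; exact: kspan_cons.
Qed.

Lemma ext_emb_free : kfree (fun b => ext_emb E phi (beta b)) (fun=> True).
Proof.
move=> s c us _ e0 b bs; have := congr1 (coeff b) e0; rewrite coeff0 => <-.
rewrite (raddf_sum (coeff b)) (bigD1_seq b) //= big1 ?addr0 => [|b' bb].
  by rewrite bext_scaleC ext_emb_vec /rscale coeffZ coeffU eqxx !mulr1.
by rewrite bext_scaleC ext_emb_vec /rscale coeffZ coeffU (negPf bb) !mulr0.
Qed.

Lemma ext_emb_span v : kspan (fun b => ext_emb E phi (beta b)) (fun=> True) v.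
Proof.
have -> : v = \sum_(b <- dom v) << coeff b v *g b >> by rewrite (freeg_sumE v).
apply: (@kspan_sum _ _ (base_ext E phi)) => b _; rewrite bextU -bext_scaleC.
by apply: kspanZ; exact: kspan_gen.
Qed.

End FunctorialExtension.

(** * Linear coordinates *)

Section LinearForms.
Variables (R : comNzRingType) (n : nat).

Definition lin_form (g : 'M[R]_n) (i : 'I_n) : {mpoly R[n]} :=
  \sum_j g i j *: 'X_j.

Lemma mmap1_homog (g : 'M[R]_n) m : mmap1 (lin_form g) m \is (mdeg m).-homog.
Proof.
rewrite /mmap1 mdegE.
apply: (big_rec2 (fun (p : {mpoly R[n]}) d => p \is d.-homog)); first exact: dhomog1.
move=> i d p _ hp; apply: dhomogM => //.
have h1 : lin_form g i \is 1.-homog.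
  by apply: rpred_sum => j _; apply: dhomogZ; rewrite dhomogX; apply/eqP; exact: mdeg1.
by have := dhomogMn (m i) h1; rewrite mul1n.
Qed.

Lemma lin_form_comp (g h : 'M[R]_n) i :
  lin_form h i \mPo [tuple lin_form g j | j < n] = lin_form (h *m g) i.
Proof.
rewrite /lin_form raddf_sum /=.
under eq_bigr => j _.
  rewrite comp_mpolyZ comp_mpolyXU -tnth_nth tnth_mktuple scaler_sumr.
  over.
rewrite exchange_big /=; apply: eq_bigr => l _; rewrite mxE scaler_suml.
by apply: eq_bigr => j _; rewrite scalerA.
Qed.

Lemma lin_form1 i : lin_form 1%:M i = 'X_i.
Proof.
rewrite /lin_form (bigD1 i) //= mxE eqxx scale1r big1 ?addr0 // => j ji.
by rewrite mxE eq_sym (negPf ji) scale0r.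
Qed.

Lemma mmap1_comp (g h : 'M[R]_n) m :
  mmap1 (lin_form (h *m g)) m =
  \sum_(a <- msupp (mmap1 (lin_form h) m))
     (mmap1 (lin_form h) m)@_a *: mmap1 (lin_form g) a.
Proof.
have -> : mmap1 (lin_form (h *m g)) m =
    mmap1 (lin_form h) m \mPo [tuple lin_form g j | j < n].
  rewrite /mmap1 rmorph_prod /=; apply: eq_bigr => i _.
  by rewrite rmorphXn /= lin_form_comp.
rewrite comp_mpolyE; apply: eq_bigr => a _; congr (_ *: _).
by apply: eq_bigr => i _; rewrite tnth_mktuple.
Qed.

End LinearForms.

Lemma map_lin_form (R R' : comNzRingType) (n : nat) (psi : {rmorphism R -> R'})
    (g : 'M[R]_n) i : map_mpoly psi (lin_form g i) = lin_form (map_mx psi g) i.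
Proof.
rewrite /lin_form raddf_sum /=; apply: eq_bigr => j _.
by rewrite map_mpolyZ map_mpolyX mxE.
Qed.

Lemma new_coordE (k : fieldType) (n : nat) (g : 'M[k]_n) :
  tnth (new_coord g) = lin_form g.
Proof. by apply/funext => i; rewrite tnth_mktuple. Qed.

(** Coordinates being linear, passing from one system to another expands a term
    into terms of the same degree. *)
Lemma term_val_change (R : comNzRingType) (n r : nat) (dlt : 'I_r -> nat)
    (P : lmodType {mpoly R[n]}) (g h : 'M[R]_n) (e : 'I_r -> P) x :
  kspan (term_val (lin_form g) e) (fun z => tdeg dlt z = tdeg dlt x)
    (term_val (lin_form (h *m g)) e x).
Proof.
rewrite /term_val mmap1_comp scaler_suml; apply: kspan_sum_mem => a.
move=> /(dhomog_mf (mmap1_homog h x.1)) da.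
rewrite -mul_mpolyC -scalerA; apply: kspanZ.
by apply: (@kspan_gen _ _ _ _ (term_val (lin_form g) e) _ (a, x.2)); rewrite /tdeg /= da.
Qed.

(** The finite lists of basis elements of each degree serve to compare by counting
    the dimensions of the components over different fields. *)
Record graded_basis (K : fieldType) (n r : nat) (M : lmodType {mpoly K[n]})
    (dlt : 'I_r -> nat) (e : 'I_r -> M) := GradedBasis {
  gb_basis :> constant_basis M;
  gb_deg : cb_index gb_basis -> nat;
  gb_list : nat -> seq (cb_index gb_basis);
  gb_list_uniq : forall d, uniq (gb_list d);
  gb_listP : forall d b, (b \in gb_list d) = (gb_deg b == d);
  gb_term : forall b, exists2 x : term n r,
    tdeg dlt x = gb_deg b & cb_vec b = term_val (lin_form 1%:M) e x;
  gb_span : forall x : term n r,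
    kspan (@cb_vec _ _ _ gb_basis) (fun b => gb_deg b = tdeg dlt x)
      (term_val (lin_form 1%:M) e x) }.

Section ExtendedTerms.
Variables (K : fieldType) (n r : nat) (M : lmodType {mpoly K[n]}).
Variables (dlt : 'I_r -> nat) (e : 'I_r -> M) (E : graded_basis dlt e).
Notation beta := (@cb_vec _ _ _ E).
Notation dB := (@gb_deg _ _ _ _ _ _ E).
Notation tdeg := (tdeg dlt).

Section Ring.
Variables (R : comNzRingType) (phi : {rmorphism K -> R}).

Definition ext_vec (b : cb_index E) : base_ext E phi := ext_emb E phi (beta b).

Definition ext_val (g : 'M[R]_n) : term n r -> base_ext E phi :=
  term_val (lin_form g) (fun j => ext_emb E phi (e j)).

Lemma ext_emb_term (h : 'M[K]_n) x :
  ext_emb E phi (term_val (lin_form h) e x) = ext_val (map_mx phi h) x.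
Proof.
rewrite /ext_val /term_val ext_emb_scale; congr (_ *: _).
rewrite /mmap1 rmorph_prod /=; apply: eq_bigr => i _.
by rewrite rmorphXn /= map_lin_form.
Qed.

Lemma ext_emb_term1 x :
  ext_emb E phi (term_val (lin_form 1%:M) e x) = ext_val 1%:M x.
Proof. by rewrite ext_emb_term map_mx1. Qed.

Lemma ext_val_deg (g : 'M[R]_n) x :
  kspan ext_vec (fun b => dB b = tdeg x) (ext_val g x).
Proof.
rewrite -[g]mulmx1; apply: kspan_trans (term_val_change dlt 1%:M g _ x) => z dz.
rewrite -/(ext_val _ _) -ext_emb_term1 -dz; apply: kspan_emb; exact: gb_span.
Qed.

Lemma ext_vec_val (g h : 'M[R]_n) b : h *m g = 1%:M ->
  kspan (ext_val g) (fun z => tdeg z = dB b) (ext_vec b).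
Proof.
move=> hg; rewrite /ext_vec; have [x <- ->] := gb_term b.
by rewrite ext_emb_term1 -hg; exact: term_val_change.
Qed.

End Ring.

Section Field.
Variables (k : fieldType) (phi : {rmorphism K -> k}) (g : 'M[k]_n).
Notation vec := (ext_vec phi).
Notation val := (ext_val phi g).
Notation std := (standard dlt (lin_form g) (fun j => ext_emb E phi (e j))).

Lemma vec_degrees_disjoint d u :
  kspan vec (fun b => dB b = d) u -> kspan vec (fun b => dB b <> d) u -> u = 0.
Proof.
apply: kfree_disjoint => [b -> //|].
by apply: kfree_mono (@ext_emb_free _ _ _ E _ phi).
Qed.

(** The components of distinct degrees are independent, so that the part of other
    degrees in a combination of terms representing u vanishes. *)
Lemma ext_val_homog (A : term n r -> Prop) d u : kspan val A u ->
  kspan vec (fun b => dB b = d) u -> kspan val (fun x => A x /\ tdeg x = d) u.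
Proof.
move=> /kspanP[s [c [us sA ue]]] ud.
have uE := ue; rewrite (bigID (fun x => tdeg x == d)) /= in uE.
set u1 := (X in u = X + _) in uE; set u2 := (X in u = _ + X) in uE.
have u1A : kspan val (fun x => A x /\ tdeg x = d) u1.
  rewrite /u1 -big_filter; apply: kspan_sum_mem => x; rewrite mem_filter.
  by case/andP=> /eqP dx /sA Ax; apply: kspanZ; exact: kspan_gen.
suff u20 : u2 = 0 by rewrite uE u20 addr0.
apply: (@vec_degrees_disjoint d).
  have -> : u2 = u - u1 by rewrite uE addrC addKr.
  apply: kspanB => //; apply: kspan_trans u1A => x [_ <-]; exact: ext_val_deg.
rewrite /u2; apply: kspan_sum => x /eqP dx; apply: kspanZ.
by apply: kspan_mono (ext_val_deg phi g x) => b ->.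
Qed.

Lemma ext_standard_free : kfree val std.
Proof.
move=> s c us sS e0 x xs; pose d := tdeg x.
apply: (@standard_free_deg _ _ _ dlt _ (lin_form g) (fun j => ext_emb E phi (e j)) d
  [seq z <- s | tdeg z == d] c _ _ _ x).
- exact: filter_uniq.
- by move=> z; rewrite mem_filter => /andP[/eqP dz /sS].
- apply: (@vec_degrees_disjoint d).
    apply: kspan_sum_mem => z; rewrite mem_filter => /andP[/eqP <- _].
    apply: kspanZ; exact: ext_val_deg.
  move: e0; rewrite (bigID (fun z => tdeg z == d)) /= big_filter => /eqP.
  rewrite addr_eq0 => /eqP ->; apply: kspanN; apply: kspan_sum => z /eqP dz.
  by apply: kspanZ; apply: kspan_mono (ext_val_deg phi g z) => b ->.
by rewrite mem_filter eqxx.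
Qed.

Hypothesis gU : g \in unitmx.

Lemma ext_vec_standard b : kspan val (fun x => std x /\ tdeg x = dB b) (vec b).
Proof.
have := ext_vec_val phi b (mulVmx gU); apply: kspan_trans => z <-.
by apply: kspan_mono (standard_span dlt _ _ z) => x [? ? _].
Qed.

Lemma ext_val_span (u : base_ext E phi) : kspan val (fun=> True) u.
Proof.
apply: kspan_trans (ext_emb_span u) => b _.
by apply: kspan_mono (ext_vec_standard b) => x _.
Qed.

Lemma ext_standard_span (u : base_ext E phi) : kspan val std u.
Proof.
apply: kspan_trans (ext_emb_span u) => b _.
by apply: kspan_mono (ext_vec_standard b) => x [].
Qed.

Definition standard_list (d : nat) : seq (term n r) :=
  [seq x <- terms_of_deg n dlt d | `[<std x>]].

Lemma standard_listP d x : (x \in standard_list d) <-> std x /\ tdeg x = d.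
Proof.
rewrite mem_filter; split=> [/andP[/asboolP sx]|[sx dx]].
  by rewrite terms_of_degP => /eqP.
by rewrite terms_of_degP dx eqxx andbT; apply/asboolP.
Qed.

(** Both sides are the dimension of the component of degree d, which depends
    neither on the field nor on the coordinates. *)
Lemma size_standard_list d : size (standard_list d) = size (gb_list E d).
Proof.
apply/eqP; rewrite eqn_leq; apply/andP; split.
  apply: (@kfree_size_le _ _ _ _ _ val vec).
  - by apply: filter_uniq; exact: terms_of_deg_uniq.
  - by apply: kfree_mono ext_standard_free => x /standard_listP[].
  move=> x /standard_listP[_ dx]; apply: kspan_mono (ext_val_deg phi g x) => b.
  by rewrite gb_listP dx => ->.
apply: (@kfree_size_le _ _ _ _ _ vec val).
- exact: gb_list_uniq.
- by apply: kfree_mono (@ext_emb_free _ _ _ E _ phi).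
move=> b; rewrite gb_listP => /eqP db; apply: kspan_mono (ext_vec_standard b) => x.
by rewrite db => /standard_listP.
Qed.

End Field.
End ExtendedTerms.

(** * Homogeneous generators and a basis of a graded module *)

Section GradedModule.
Variables (K : fieldType) (n : nat) (M : lmodType {mpoly K[n]}).
Variables (Md : int -> set M) (hMd : is_grading Md).

Lemma grading_add d u v : Md d u -> Md d v -> Md d (u + v).
Proof.
move=> ud vd; rewrite -[v]opprK; apply: (gradingB hMd) => //.
by rewrite -sub0r; apply: (gradingB hMd) => //; exact: (grading0 hMd).
Qed.

Lemma grading_scaleC d c u : Md d u -> Md d (c%:MP *: u).
Proof.
move=> ud; rewrite -[d]add0r; apply: (gradingM hMd) => //.
by rewrite -alg_mpolyC; apply: dhomogZ; exact: dhomog1.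
Qed.

(** Take the homogeneous components of the given generators; the base is chosen
    below all their degrees, which then are natural numbers. *)
Lemma homog_generators : fin_generated M ->
  exists (r : nat) (e : 'I_r -> M) (dlt : 'I_r -> nat) (base : int),
    (forall j, Md (base + (dlt j)%:Z) (e j)) /\
    (forall u, exists p : 'I_r -> {mpoly K[n]}, u = \sum_j p j *: e j).
Proof.
move=> [k [e0 gen]].
have /choice[s] : forall j, exists s : seq int, exists c : int -> M,
    [/\ uniq s, forall d, Md d (c d) & e0 j = \sum_(d <- s) c d].
  by move=> j; exact: (grading_span hMd).
move=> /choice[c cP].
pose L := [seq (j, d) | j <- enum 'I_k, d <- s j].
pose base := - (\sum_(x <- L) `|x.2|%N)%:Z.
pose e (i : 'I_(size L)) := let x := tnth (in_tuple L) i in c x.1 x.2.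
pose dlt (i : 'I_(size L)) := `|(tnth (in_tuple L) i).2 - base|%N.
exists (size L), e, dlt, base; split=> [i|u].
  rewrite /e /dlt; set x := tnth _ _.
  have le : (`|x.2|%N <= \sum_(x <- L) `|x.2|%N)%N.
    rewrite -[X in (_ <= \sum_(x <- X) _)%N]/(tval (in_tuple L)) big_tuple.
    by rewrite (bigD1 i) //= leq_addr.
  have -> : base + `|x.2 - base|%N%:Z = x.2 by rewrite /base; lia.
  by have [_ + _] := cP x.1; exact.
have [p ->] := gen u.
exists (fun i => p (tnth (in_tuple L) i).1).
transitivity (\sum_(x <- L) p x.1 *: c x.1 x.2); last first.
  by rewrite -[X in \sum_(x <- X) _]/(tval (in_tuple L)) big_tuple.
rewrite /L big_allpairs_dep /= big_enum /=; apply: eq_bigr => j _.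
by rewrite -scaler_sumr; have [_ _ <-] := cP j.
Qed.

Variables (r : nat) (e : 'I_r -> M) (dlt : 'I_r -> nat) (base : int).
Hypothesis e_homog : forall j, Md (base + (dlt j)%:Z) (e j).
Hypothesis e_gen : forall u, exists p : 'I_r -> {mpoly K[n]}, u = \sum_j p j *: e j.
Notation tdeg := (tdeg dlt).
Notation val := (term_val (lin_form 1%:M) e).
Notation std := (standard dlt (lin_form 1%:M) e).

Lemma term_val_homog (g : 'M[K]_n) c x :
  Md (base + (tdeg x)%:Z) (c%:MP *: term_val (lin_form g) e x).
Proof.
apply: grading_scaleC; rewrite /tdeg PoszD addrCA.
exact: (gradingM hMd) (mmap1_homog g x.1) (e_homog x.2).
Qed.

(** By the grading a relation splits into relations inside single degrees. *)
Lemma module_standard_free : kfree val std.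
Proof.
move=> s c us sS e0 x xs.
pose dg (z : term n r) : int := base + (tdeg z)%:Z.
pose u (d : int) := \sum_(z <- s | dg z == d) (c z)%:MP *: val z.
have u0 : u (dg x) = 0.
  apply: (grading_free hMd (s := undup (map dg s)) (c := u)).
  - exact: undup_uniq.
  - move=> d; apply: (big_ind (Md d)); first exact: (grading0 hMd).
      exact: grading_add.
    by move=> z /eqP <-; exact: term_val_homog.
  - by rewrite /u sum_undup_fibers.
  by rewrite mem_undup map_f.
apply: (@standard_free_deg _ _ _ dlt _ (lin_form 1%:M) e (tdeg x)
  [seq z <- s | tdeg z == tdeg x] c _ _ _ x).
- exact: filter_uniq.
- by move=> z; rewrite mem_filter => /andP[/eqP dz /sS].
- rewrite big_filter -[RHS]u0; apply: eq_bigl => z.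
  by rewrite /dg (inj_eq (addrI _)) eqz_nat.
by rewrite mem_filter eqxx.
Qed.

Lemma module_standard_span u : kspan val std u.
Proof.
have [p ->] := e_gen u; apply: kspan_sum => j _.
rewrite [X in X *: _]mpolyE scaler_suml; apply: kspan_sum => m _.
rewrite -mul_mpolyC -scalerA; apply: kspanZ.
have -> : 'X_[m] *: e j = val (m, j).
  rewrite /term_val /=; congr (_ *: _); rewrite -mmap1_id.
  by apply: mmap1_eq => i; rewrite lin_form1.
by apply: kspan_mono (standard_span dlt _ _ _) => x [].
Qed.

Definition standard_term := {x : term n r | `[< std x >]}.

Definition standard_vec (b : standard_term) : M := val (\val b).

Lemma standard_vec_free : kfree standard_vec (fun=> True).
Proof.
apply: (@kfree_comp _ _ _ _ _ val (fun b : standard_term => \val b) std) module_standard_free.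
  by move=> b _; apply/asboolP; exact: (valP b).
by move=> b b' _ _ /val_inj.
Qed.

Lemma standard_vec_span S u :
  kspan val (fun x => std x /\ S x) u -> kspan standard_vec (fun b => S (\val b)) u.
Proof.
apply: kspan_trans => x [/asboolP sx Sx].
pose b : standard_term := Sub x sx.
by have := @kspan_gen _ _ _ _ standard_vec (fun b => S (\val b)) b Sx.
Qed.

Definition standard_basis : constant_basis M.
Proof.
exists standard_term standard_vec; first exact: standard_vec_free.
move=> u; apply: (@standard_vec_span (fun=> True)).
by apply: kspan_mono (module_standard_span u).
Defined.

Definition standard_graded_basis : graded_basis dlt e.
Proof.
exists standard_basis (fun b : standard_term => tdeg (\val b))
  (fun d => pmap (insub : term n r -> option standard_term) (terms_of_deg n dlt d)).
- by move=> d; apply: pmap_sub_uniq; exact: terms_of_deg_uniq.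
- by move=> d b; rewrite mem_pmap_sub terms_of_degP.
- by move=> b; exists (\val b).
move=> x; apply: (@standard_vec_span (fun z => tdeg z = tdeg x)).
by apply: kspan_mono (standard_span dlt _ _ x) => z [].
Defined.

End GradedModule.

(** * Finiteness of monomial ideals *)

Definition up_closed (n : nat) (C : (nat -> nat) -> Prop) : Prop :=
  forall f f', (forall i, (i < n)%N -> (f i <= f' i)%N) -> C f -> C f'.

(** Dickson's lemma: membership in a monomial ideal is not affected by
    truncating the exponents at a suitable bound.  The ideals of the slices
    x_n = s increase with s, and only finitely many truncated exponents occur
    in their union, so that they are stable on those from some s0 on. *)
Lemma dickson_nat n (C : (nat -> nat) -> Prop) : up_closed n C ->
  exists D, forall f, C f -> C (fun i => minn (f i) D).
Proof.
elim: n C => [|n IH] C Cup.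
  by exists 0%N => f; apply: Cup.
pose upd (f : nat -> nat) s i := if i == n then s else f i.
pose slice s f := C (upd f s).
have sup s : up_closed n (slice s).
  move=> f f' ff'; apply: Cup => i; rewrite ltnS leq_eqVlt /upd => /orP[->//|i_n].
  by rewrite ltn_eqF ?ff'.
have [D' hD'] : exists D, forall f, (exists s, slice s f) ->
    exists s, slice s (fun i => minn (f i) D).
  apply: (IH (fun f => exists s, slice s f)) => f f' ff' [s sf].
  by exists s; apply: sup sf.
pose ext (h : {ffun 'I_n -> 'I_D'.+1}) i := if insub i is Some j then h j : nat else 0%N.
have /choice[st stP] : forall h, exists s, (exists s', slice s' (ext h)) -> slice s (ext h).
  move=> h; have [[s sh]|nh] := pselect (exists s', slice s' (ext h)).
    by exists s.
  by exists 0%N.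
(* s0: from here on the slices contain all truncated points of their union *)
pose s0 := \max_h st h.
have /choice[Ds DsP] : forall s, exists D, forall f, slice s f -> slice s (fun i => minn (f i) D).
  by move=> s; apply: IH.
pose D := maxn D' (maxn s0 (\max_(s < s0.+1) Ds s)).
exists D => f Cf; have [fs|fs] := leqP (f n) s0.
  have /DsP : slice (f n) f.
    by apply: Cup Cf => i _; rewrite /upd; case: eqP => // ->.
  apply: Cup => i _; rewrite /upd; case: eqP => [->|_].
    by rewrite leq_min leqnn /= /D (leq_trans fs) // !leq_max leqnn orbT.
  have le : (Ds (f n) <= D)%N.
    have fs' : (f n < s0.+1)%N by [].
    have := @leq_bigmax _ (fun s : 'I_s0.+1 => Ds s) (Ordinal fs').
    by rewrite /D !leq_max /= => ->; rewrite !orbT.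
  by rewrite leq_min geq_minl /= (leq_trans (geq_minr _ _)).
have [s hs] : exists s, slice s (fun i => minn (f i) D').
  apply: hD'; exists (f n).
  by apply: Cup Cf => i _; rewrite /upd; case: eqP => // ->.
pose h : {ffun 'I_n -> 'I_D'.+1} := [ffun i : 'I_n => inord (minn (f i) D')].
have extE i : (i < n)%N -> ext h i = minn (f i) D'.
  by move=> i_n; rewrite /ext insubT ffunE inordK // ltnS geq_minr.
have : slice (st h) (ext h).
  by apply: stP; exists s; apply: sup hs => i i_n; rewrite extE.
have sth : (st h <= s0)%N by exact: (@leq_bigmax _ st).
apply: Cup => i; rewrite ltnS leq_eqVlt /upd => /orP[/eqP->|i_n].
  by rewrite eqxx leq_min (leq_trans sth) ?(ltnW fs) // /D !leq_max sth orbT.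
rewrite ltn_eqF // extE // leq_min geq_minl (leq_trans (geq_minr _ _)) //.
by rewrite leq_maxl.
Qed.

Lemma dickson n (C : 'X_{1..n} -> Prop) : (forall m a, C m -> C (a + m)%MM) ->
  exists D, forall m, C m -> C [multinom minn (m i) D | i < n].
Proof.
move=> Cup; pose C' f := C [multinom f (val i) | i < n].
have [|D DP] := @dickson_nat n C'.
  move=> f f' ff' Cf; rewrite /C'.
  have -> : [multinom f' (val i) | i < n] =
    ([multinom f' (val i) - f (val i) | i < n] + [multinom f (val i) | i < n])%MM.
    by apply/mnmP => i; rewrite mnmDE !mnmE subnK // ff' /=.
  exact: Cup.
exists D => m Cm; pose f i := if insub i is Some j then m j else 0%N.
have fE (i : 'I_n) : f (val i) = m i by rewrite /f valK.
have : C' f by rewrite /C' (_ : [multinom _ | i < n] = m) //; apply/mnmP => i; rewrite mnmE fE.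
move/DP; rewrite /C' (_ : [multinom _ | i < n] = [multinom minn (m i) D | i < n]) //.
by apply/mnmP => i; rewrite !mnmE fE.
Qed.

Section RevlexTail.
Variables (n r : nat).

Lemma revlex_cancel m (x y : term n r) :
  revlex_lt (tmul m x) (tmul m y) -> revlex_lt x y.
Proof.
case=> [[i [xi xj]]|[/addmI xy lxy]]; [left|by right].
exists i; move: xi; rewrite /= !mnmDE ltn_add2l; split=> // j /xj.
by rewrite /= !mnmDE => /addnI.
Qed.

Lemma revlex_lt_tail (i k : 'I_n) (z x : term n r) : (i < k)%N -> (0 < z.1 k)%N ->
  (forall l : 'I_n, (i < l)%N -> x.1 l = 0%N) -> revlex_lt z x.
Proof.
move=> ik zk x0; left.
have [l hl lmax] :=
  @arg_maxnP _ k (fun l => (0 < z.1 l)%N) (fun l : 'I_n => l : nat) zk.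
have il : (i < l)%N by apply: leq_trans ik _; exact: lmax.
exists l; split=> [|j lj]; first by rewrite x0.
rewrite x0 ?(ltn_trans il) //; apply/eqP; rewrite -leqn0 leqNgt; apply/negP.
by move/lmax; rewrite /=; lia.
Qed.

(** From the last variable down to the first difference the exponents of z are
    those of x_i w, and there that of z is larger: so z contains x_i. *)
Lemma revlex_lt_step (i : 'I_n) (z w : term n r) : revlex_lt z (tmul U_(i)%MM w) ->
  (forall l : 'I_n, (i < l)%N -> z.1 l = 0%N) ->
  exists2 z', z = tmul U_(i)%MM z' & revlex_lt z' w.
Proof.
move=> zw z0; have zi : (0 < z.1 i)%N.
  case: zw => [[p [pz pe]]|[-> _]]; last by rewrite /= mnmDE mnm1E eqxx.
  have [ip|pi|/val_inj ip] := ltngtP i p.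
  - by move: pz; rewrite z0.
  - by rewrite pe //= mnmDE mnm1E eqxx.
  - by move: pz; rewrite ip /=; case: (z.1 p).
have zE : z = tmul U_(i)%MM ((z.1 - U_(i))%MM, z.2).
  by rewrite /tmul /= addmC submK ?lep1mP -?lt0n // -surjective_pairing.
exists ((z.1 - U_(i))%MM, z.2) => //.
by apply: (@revlex_cancel U_(i)%MM); rewrite -zE.
Qed.

End RevlexTail.

(** * Generic coordinates *)

Section TailSubmodule.
Variables (R : comNzRingType) (n : nat) (P : lmodType {mpoly R[n]}).
Variables (y : 'I_n -> {mpoly R[n]}) (i : nat).

(** The submodule (y_{i+1}, ..., y_{n-1}) P. *)
Definition tail_sub (u : P) : Prop :=
  exists w : 'I_n -> P, u = \sum_(k < n | (i < k)%N) y k *: w k.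

Lemma tail_sub0 : tail_sub 0.
Proof. by exists (fun=> 0); rewrite big1 // => k _; rewrite scaler0. Qed.

Lemma tail_subD u v : tail_sub u -> tail_sub v -> tail_sub (u + v).
Proof.
move=> [w ->] [w' ->]; exists (fun k => w k + w' k); rewrite -big_split /=.
by apply: eq_bigr => k _; rewrite scalerDr.
Qed.

Lemma tail_subZ p u : tail_sub u -> tail_sub (p *: u).
Proof.
move=> [w ->]; exists (fun k => p *: w k); rewrite scaler_sumr.
by apply: eq_bigr => k _; rewrite !scalerA mulrC.
Qed.

Lemma tail_subB u v : tail_sub u -> tail_sub v -> tail_sub (u - v).
Proof. by move=> hu hv; rewrite -scaleN1r; apply: tail_subD => //; exact: tail_subZ. Qed.

Lemma tail_sub_sum (J : Type) (s : seq J) (A : pred J) F :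
  (forall j, A j -> tail_sub (F j)) -> tail_sub (\sum_(j <- s | A j) F j).
Proof. by move=> H; apply: (big_ind tail_sub); [exact: tail_sub0|exact: tail_subD|]. Qed.

Lemma tail_sub_gen (k : 'I_n) u : (i < k)%N -> tail_sub (y k *: u).
Proof.
move=> ik; exists (fun l => if l == k then u else 0); rewrite (bigD1 k) //= eqxx.
by rewrite big1 ?addr0 // => l /andP[_ /negPf ->]; rewrite scaler0.
Qed.

(** A monomial of degree n s is divisible by the s-th power of some variable. *)
Lemma tail_sub_homog s (p : {mpoly R[n]}) u : (0 < n)%N ->
  (forall j : 'I_n, tail_sub ('X_j ^+ s *: u)) -> p \is (n * s).-homog ->
  tail_sub (p *: u).
Proof.
move=> n0 hs hp; rewrite (mpolyE p) scaler_suml big_seq.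
apply: tail_sub_sum => m /(dhomog_mf hp) /= dm.
have [j js] : exists j, (s <= m j)%N.
  apply/existsP; apply/negbNE/negP; rewrite negb_exists => /forallP h.
  have : (\sum_(j < n) (m j).+1 <= \sum_(j < n) s)%N.
    by apply: leq_sum => j _; rewrite ltnNge.
  rewrite sum_nat_const card_ord -dm mdegE.
  rewrite (eq_bigr (fun j => m j + 1)%N) => [|j _]; last by rewrite addn1.
  by rewrite big_split /= sum1_card card_ord; lia.
have -> : m = (m - U_(j) *+ s + U_(j) *+ s)%MM.
  rewrite submK //; apply/mnm_lepP => l; rewrite mulmnE mnm1E.
  by case: eqP => [<-|_]; rewrite ?mul1n ?mul0n.
rewrite mpolyXD -mpolyXn -mul_mpolyC mulrA -scalerA; apply: tail_subZ; exact: hs.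
Qed.

End TailSubmodule.

Section GenericRing.
Variables (K : fieldType) (n : nat) (M : lmodType {mpoly K[n]}).
Variables (E : constant_basis M).
Notation R := {mpoly K[n * n]}.

Definition poly_const : {rmorphism K -> R} := (@mpolyC (n * n) K : {rmorphism _ -> _}).

Definition generic_mx : 'M[R]_n := \matrix_(i, j) 'X_(mxvec_index i j).

Notation ext := (base_ext E poly_const).
Notation y := (lin_form generic_mx).

Section OneEntry.
Variables (i j : 'I_n).
Notation ij := (mxvec_index i j).

(** A polynomial in the entries of the generic matrix, as a polynomial in the
    (i, j) entry with coefficients in the same ring. *)
Definition in_entry : {rmorphism R -> {poly R}} :=
  (mmap (polyC \o @mpolyC (n * n) K) (fun l => if l == ij then 'X else ('X_l)%:P)
    : {rmorphism _ -> _}).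

Lemma in_entryC c : in_entry c%:MP = (c%:MP)%:P.
Proof. exact: mmapC. Qed.

Lemma in_entryX l : in_entry 'X_l = if l == ij then 'X else ('X_l)%:P.
Proof. by rewrite /in_entry /= mmapX mmap1U. Qed.

Lemma in_entryK c : (in_entry c).['X_ij] = c.
Proof.
apply: (@mpoly_additive_ext _ _ _ (fun c => (in_entry c).['X_ij]) id) => [a b|//|a m].
  by rewrite raddfB hornerD hornerN.
rewrite -mul_mpolyC rmorphM in_entryC hornerCM; congr (_ * _).
rewrite /in_entry /= mmapX /mmap1 horner_prod [RHS]mpolyXE_id.
apply: eq_bigr => l _; rewrite horner_exp.
by case: eqP => [->|_]; rewrite ?hornerX ?hornerC.
Qed.

Definition entry_coef (a : nat) (c : R) : R := (in_entry c)`_a.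

Lemma entry_coef_additive a : additive (entry_coef a).
Proof. by move=> c d; rewrite /entry_coef raddfB coefB. Qed.
HB.instance Definition _ a :=
  GRing.isAdditive.Build R R (entry_coef a) (entry_coef_additive a).

Lemma entry_coef_lin a c d :
  entry_coef a (c * poly_const d) = entry_coef a c * poly_const d.
Proof. by rewrite /entry_coef rmorphM in_entryC coefMC. Qed.

Lemma entry_coef_other a l c : l != ij ->
  entry_coef a ('X_l * c) = 'X_l * entry_coef a c.
Proof. by move=> /negPf lij; rewrite /entry_coef rmorphM in_entryX lij coefCM. Qed.

Lemma entry_coef_this a c : entry_coef a.+1 ('X_ij * c) = entry_coef a c.
Proof. by rewrite /entry_coef rmorphM in_entryX eqxx coefXM. Qed.

Notation ecoef a := (ext_map (E := E) (phi := poly_const) poly_const (entry_coef a)).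

Lemma ext_map_rscale_gen (f f' : {additive R -> R}) c c' (v : ext) :
  (forall d, f (c * d) = c' * f' d) ->
  ext_map poly_const f (rscale c v) = rscale c' (ext_map poly_const f' v).
Proof.
move=> h; apply/eqP/freeg_eqP => b.
by rewrite /ext_map /rscale coeffZ !coeff_freeg_map coeffZ.
Qed.

Lemma ecoef_X a l (v : ext) : ecoef a ('X_l *: v) = 'X_l *: ecoef a v.
Proof. by apply: ext_map_X; exact: entry_coef_lin. Qed.

Lemma lin_form_scale k (v : ext) :
  y k *: v = \sum_l rscale ('X_(mxvec_index k l)) ('X_l *: v).
Proof.
rewrite /lin_form scaler_suml; apply: eq_bigr => l _.
by rewrite mxE -mul_mpolyC -scalerA bext_scaleC.
Qed.

Lemma index_neq k l : (k != i) || (l != j) -> mxvec_index k l != ij.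
Proof.
apply: contraL => /eqP /(congr1 (enum_val \o cast_ord (esym (mxvec_cast n n)))).
rewrite /= /mxvec_index !cast_ordK !enum_rankK => -[-> ->].
by rewrite !eqxx.
Qed.

Lemma ecoef_other a k (v : ext) : k != i -> ecoef a (y k *: v) = y k *: ecoef a v.
Proof.
move=> ki; rewrite !lin_form_scale raddf_sum; apply: eq_bigr => l _ /=.
rewrite (ext_map_rscale_gen (c' := 'X_(mxvec_index k l)) (f' := entry_coef a)).
  by rewrite ecoef_X.
by move=> d; rewrite /= entry_coef_other // index_neq // ki.
Qed.

Notation rest := (\sum_(l | l != j) (generic_mx i l) *: 'X_l).

Lemma ecoef_this a (v : ext) :
  ecoef a.+1 (y i *: v) = 'X_j *: ecoef a v + rest *: ecoef a.+1 v.
Proof.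
rewrite lin_form_scale raddf_sum (bigD1 j) //=; congr (_ + _).
  rewrite (ext_map_rscale_gen (c' := 1) (f' := entry_coef a)).
    by rewrite rscale1 ecoef_X.
  by move=> d; rewrite /= entry_coef_this mul1r.
rewrite scaler_suml; apply: eq_bigr => l lj.
rewrite (ext_map_rscale_gen (c' := 'X_(mxvec_index i l)) (f' := entry_coef a.+1)).
  by rewrite ecoef_X mxE -mul_mpolyC -scalerA bext_scaleC.
by move=> d; rewrite /= entry_coef_other // index_neq // lj orbT.
Qed.

Lemma ecoef_bound (v : ext) : exists A : nat,
  (forall a, (A <= a)%N -> ecoef a v = 0) /\
  v = \sum_(a < A) rscale ('X_ij ^+ a) (ecoef a v).
Proof.
pose A := \max_(b <- dom (v : {freeg _ / _})) size (in_entry (coeff b v)).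
have sz b : (size (in_entry (coeff b v)) <= A)%N.
  have [bv|/coeff_outdom ->] := boolP (b \in dom (v : {freeg _ / _})).
    exact: leq_bigmax_seq.
  by rewrite raddf0 size_poly0.
exists A; split=> [a Aa|].
  apply/eqP/freeg_eqP => b; rewrite /ext_map coeff_freeg_map coeff0 /=.
  by rewrite /entry_coef nth_default // (leq_trans (sz b)).
apply/eqP/freeg_eqP => b; rewrite (raddf_sum (coeff b)) /=.
rewrite -{1}[coeff b v]in_entryK (horner_coef_wide _ (sz b)).
apply: eq_bigr => a _; rewrite /rscale coeffZ mulrC; congr (_ * _).
by rewrite /ext_map coeff_freeg_map.
Qed.

(** If y_i kills u modulo (y_{i+1}, ..., y_{n-1}), compare the coefficients of the
    powers of the indeterminate t = t_ij in (t x_j + rest) u = 0: the top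
    coefficient of u is killed by x_j, the next one by x_j^2, and so on. *)
Lemma tail_sub_annihilated (u : ext) : tail_sub y i (y i *: u) ->
  exists A, tail_sub y i ('X_j ^+ A *: u).
Proof.
move=> [w uw]; have [A [A0 uE]] := ecoef_bound u; exists A.
have step b a : (A <= a + b)%N -> tail_sub y i ('X_j ^+ b *: ecoef a u).
  elim: b a => [|b IH] a ab.
    by rewrite A0 ?scaler0; [exact: tail_sub0|rewrite addn0 in ab].
  rewrite exprSr -scalerA.
  have -> : 'X_j *: ecoef a u = ecoef a.+1 (y i *: u) - rest *: ecoef a.+1 u.
    by rewrite ecoef_this addrK.
  rewrite scalerBr; apply: tail_subB.
    apply: tail_subZ; rewrite uw raddf_sum; apply: tail_sub_sum => k ik /=.
    rewrite ecoef_other; first exact: tail_sub_gen.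
    by rewrite -(inj_eq val_inj) neq_ltn ik orbT.
  rewrite scalerA mulrC -scalerA; apply: tail_subZ; apply: IH.
  by rewrite addSnnS.
rewrite [in X in tail_sub _ _ X]uE scaler_sumr; apply: tail_sub_sum => a _.
rewrite -bext_scaleC scalerA mulrC -scalerA; apply: tail_subZ; apply: step.
exact: leq_addl.
Qed.

End OneEntry.
End GenericRing.

Lemma frac_repr (R : idomainType) (c : {fraction R}) :
  exists2 b : R, b != 0 & exists a, FracField.tofrac b * c = FracField.tofrac a.
Proof.
elim/quotW: c => x; exists (frac x).2; first exact: denom_ratioP.
exists (frac x).1; unlock FracField.tofrac; rewrite -[LHS]FracField.pi_mul.
apply/eqmodP; rewrite /= FracField.equivfE /FracField.mulf.
by rewrite !numden_Ratio ?oner_eq0 ?mul1r ?mulr1 ?denom_ratioP.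
Qed.

(** Over the field of fractions everything is brought back to polynomials in the
    t_ij by multiplication by a common denominator. *)
Section GenericField.
Variables (K : fieldType) (n : nat) (M : lmodType {mpoly K[n]}).
Variables (E : constant_basis M).
Notation R := {mpoly K[n * n]}.
Notation L := {fraction R}.
Notation tofrac := (@FracField.tofrac R).

Definition frac_const : {rmorphism K -> L} :=
  (tofrac \o @mpolyC (n * n) K : {rmorphism _ -> _}).

Notation ext := (base_ext E (poly_const K n)).
Notation extL := (base_ext E frac_const).
Definition frac_map : ext -> extL := ext_map frac_const (tofrac : {rmorphism _ -> _}).

Lemma frac_mapB : {morph frac_map : u v / u - v}.
Proof. exact: ext_mapB. Qed.
HB.instance Definition _ := GRing.isAdditive.Build ext extL frac_map frac_mapB.

Lemma frac_map_scale p u : frac_map (p *: u) = map_mpoly tofrac p *: frac_map u.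
Proof. exact: ext_map_scale. Qed.

Lemma frac_map_rscale c u : frac_map (rscale c u) = rscale (tofrac c) (frac_map u).
Proof. exact: ext_map_rscale. Qed.

Lemma frac_map_emb u : frac_map (ext_emb E _ u) = ext_emb E _ u.
Proof. exact: ext_map_emb. Qed.

Lemma frac_map_inj : injective frac_map.
Proof. by apply: ext_map_inj => a b /eqP; rewrite tofrac_eq => /eqP. Qed.

Definition generic_frac : 'M[L]_n := map_mx tofrac (generic_mx K n).

Lemma map_generic_mx (k : comNzRingType) (phi : {rmorphism K -> k}) (g : 'M[k]_n) :
  map_mx (mmap phi (mxvec g 0)) (generic_mx K n) = g.
Proof. by apply/matrixP => i j; rewrite !mxE mmapX mmap1U mxvecE. Qed.

Lemma det_generic_neq0 : \det (generic_mx K n) != 0.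
Proof.
apply/eqP => /(congr1 (mmap idfun (mxvec (1%:M : 'M[K]_n) 0))).
by rewrite -det_map_mx map_generic_mx det1 raddf0 => /eqP; rewrite oner_eq0.
Qed.

Lemma generic_frac_unit : generic_frac \in unitmx.
Proof. by rewrite unitmxE unitfE det_map_mx tofrac_eq0 det_generic_neq0. Qed.

Lemma clear_denominator (v : extL) :
  exists2 f : R, f != 0 & exists w, rscale (tofrac f) v = frac_map w.
Proof.
elim: (ext_emb_span v) => [|c b w _ _ [f f0 [u uE]]].
  by exists 1; [exact: oner_neq0|exists 0; rewrite !raddf0].
have [d d0 [a da]] := frac_repr c.
exists (d * f); first by rewrite mulf_neq0.
exists (rscale (a * f) (ext_emb E _ (cb_vec b)) + rscale d u).
rewrite !raddfD /= !frac_map_rscale frac_map_emb bext_scaleC rscaleA.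
by rewrite -uE rscaleA !rmorphM /= mulrAC da.
Qed.

Lemma clear_denominators (I : finType) (v : I -> extL) :
  exists2 f : R, f != 0 &
    exists w : I -> ext, forall i, rscale (tofrac f) (v i) = frac_map (w i).
Proof.
have /choice[f fP] : forall i, exists f : R,
    f != 0 /\ exists w, rscale (tofrac f) (v i) = frac_map w.
  by move=> i; have [f f0 fw] := clear_denominator (v i); exists f.
have /choice[w wP] : forall i, exists w, rscale (tofrac (f i)) (v i) = frac_map w.
  by move=> i; case: (fP i).
exists (\prod_i f i); first by apply/prodf_neq0 => i _; case: (fP i).
exists (fun i => rscale (\prod_(j | j != i) f j) (w i)) => i.
by rewrite frac_map_rscale -wP rscaleA -rmorphM (bigD1 i) //= mulrC.
Qed.

Notation yR := (lin_form (generic_mx K n)).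
Notation y := (lin_form generic_frac).

Lemma frac_map_y i u : frac_map (yR i *: u) = y i *: frac_map u.
Proof. by rewrite frac_map_scale map_lin_form. Qed.

Lemma tail_sub_generic (i : 'I_n) (u : extL) : tail_sub y i (y i *: u) ->
  forall j, exists A, tail_sub y i ('X_j ^+ A *: u).
Proof.
move=> [w uw] j.
have [f f0 [v vE]] := clear_denominators (fun o : option 'I_n => if o is Some k then w k else u).
have := vE None; set u' := v None => /= uE.
have [|A [w' wE]] := @tail_sub_annihilated _ _ _ E i j u'.
  exists (fun k => v (Some k)); apply: frac_map_inj.
  rewrite frac_map_y -uE -bext_scaleC scalerA mulrC -scalerA uw scaler_sumr.
  rewrite raddf_sum; apply: eq_bigr => k _ /=.
  by rewrite frac_map_y -vE -bext_scaleC !scalerA mulrC.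
exists A; have fL0 : tofrac f != 0 by rewrite tofrac_eq0.
have -> : u = (tofrac f)^-1%:MP *: frac_map u'.
  by rewrite -uE -bext_scaleC scalerA -mpolyCM mulVf // mpolyC1 scale1r.
rewrite scalerA mulrC -scalerA; apply: tail_subZ.
exists (fun k => frac_map (w' k)).
have := congr1 frac_map wE; rewrite frac_map_scale rmorphXn /= map_mpolyX => ->.
by rewrite raddf_sum; apply: eq_bigr => k _ /=; rewrite frac_map_y.
Qed.

(** A large power of y_l is a combination of monomials each divisible by a large
    power of some x_j, and these send u into the submodule. *)
Lemma tail_sub_power (i : 'I_n) (u : extL) : tail_sub y i (y i *: u) ->
  exists N, forall l : 'I_n, tail_sub y i (mmap1 y (U_(l) *+ N)%MM *: u).
Proof.
move=> /tail_sub_generic /choice[A AP].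
pose s := \max_j A j; exists (n * s)%N => l.
apply: (@tail_sub_homog _ _ _ _ _ s) => [|j|].
- exact: leq_ltn_trans (ltn_ord i).
- have As : (A j <= s)%N by exact: leq_bigmax.
  by rewrite -(subnK As) exprD -scalerA; apply: tail_subZ.
by have := mmap1_homog generic_frac (U_(l) *+ (n * s))%MM; rewrite mdegMn mdeg1 mul1n.
Qed.

End GenericField.

Section GenericStandard.
Variables (K : fieldType) (n r : nat) (M : lmodType {mpoly K[n]}).
Variables (dlt : 'I_r -> nat) (e : 'I_r -> M) (E : graded_basis dlt e).
Notation R := {mpoly K[n * n]}.
Notation L := {fraction R}.
Notation tdeg := (tdeg dlt).
Notation gL := (@generic_frac K n).
Notation y := (lin_form gL).
Notation phiL := (@frac_const K n).
Notation val := (ext_val E phiL gL).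
Notation vec := (ext_vec E phiL).

Definition generic_standard : term n r -> Prop :=
  standard dlt (lin_form gL) (fun j => ext_emb E phiL (e j)).

Lemma ext_val_tmul m x : val (tmul m x) = mmap1 y m *: val x.
Proof. exact: term_val_tmul. Qed.

Lemma scale_step (S : comNzRingType) (P : lmodType S) (a b : S) (u v q w : P) :
  w = b *: u -> a *: w + (b *: v + q) = b *: (a *: u + v) + q.
Proof. by move->; rewrite scalerDr !scalerA mulrC addrA. Qed.

Lemma tail_sub_span i (u : base_ext E phiL) : tail_sub y i u ->
  kspan val (fun z => exists2 k : 'I_n, (i < k)%N & (0 < z.1 k)%N) u.
Proof.
move=> [w ->]; apply: kspan_sum => k ik; rewrite -[y k]mmap1U.
apply: (@kspan_tmul _ _ _ _ y (fun j => ext_emb E phiL (e j)) (fun=> True)).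
  by move=> z _; exists k; rewrite //= mnmDE mnm1E eqxx.
exact (ext_val_span (E := E) (phi := phiL) (generic_frac_unit K n) (w k)).
Qed.

(** The relation that makes y_i x nonstandard gives u = x - v with v made of terms
    smaller than x and y_i u in Q = (y_{i+1}, ..., y_{n-1}) M.  A power y_l^N sends
    u into Q, and the elements of Q are combinations of terms involving a variable
    after y_i, which precede y_l^N x; so y_l^N x is not standard. *)
Lemma generic_quasi_stable (i : 'I_n) x : generic_standard x ->
  (forall l : 'I_n, (i < l)%N -> x.1 l = 0%N) ->
  ~ generic_standard (tmul U_(i)%MM x) ->
  exists N, forall l : 'I_n, (l <= i)%N ->
    ~ generic_standard (tmul (U_(l) *+ N)%MM x).
Proof.
move=> sx x0 /contrapT nsx.
(* modulo (y_{i+1}, ..., y_{n-1}), the relation on y_i x is divisible by y_i *)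
have step u : kspan val (fun z => tdeg z = tdeg (tmul U_(i)%MM x) /\
      revlex_lt z (tmul U_(i)%MM x)) u -> exists v q,
    [/\ kspan val (fun z => tdeg z = tdeg x /\ revlex_lt z x) v, tail_sub y i q &
        u = y i *: v + q].
  elim=> {u} [|c z u [dz zx] _ [v [q [vS qS ->]]]].
    by exists 0, 0; split; [left|exact: tail_sub0|rewrite scaler0 addr0].
  have [[k ik zk]|z0] := pselect (exists2 k : 'I_n, (i < k)%N & (0 < z.1 k)%N).
    exists v, (c%:MP *: val z + q); split; [exact: vS| |by rewrite addrCA].
    apply: tail_subD; last exact: qS.
    apply: tail_subZ.
    have -> : z = tmul U_(k)%MM ((z.1 - U_(k))%MM, z.2).
      by rewrite /tmul /= addmC submK ?lep1mP -?lt0n // -surjective_pairing.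
    by rewrite ext_val_tmul mmap1U; exact: tail_sub_gen.
  have [|z' zE z'x] := revlex_lt_step zx.
    move=> l il; apply/eqP; rewrite -leqn0 leqNgt; apply/negP => zl.
    by apply: z0; exists l.
  exists (c%:MP *: val z' + v), q; split; [|exact: qS|].
    apply: kspan_cons; last exact: vS.
    by split; [move: dz; rewrite zE !tdegM; lia|exact: z'x].
  by apply: scale_step; rewrite zE ext_val_tmul mmap1U.
have [v [q [vS qS E0]]] := step _ nsx.
have [|N NP] := @tail_sub_power _ _ _ E i (val x - v).
  move: E0; rewrite -/(val _) ext_val_tmul mmap1U scalerBr => ->.
  by rewrite addrC addKr.
exists N => l li sN; apply: sN.
pose z0 := tmul (U_(l) *+ N)%MM x.
have z00 (p : 'I_n) : (i < p)%N -> z0.1 p = 0%N.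
  move=> ip; rewrite /= mnmDE x0 // mulmnE mnm1E.
  by rewrite -(inj_eq val_inj) ltn_eqF ?mul0n // (leq_ltn_trans li).
pose q' := mmap1 y (U_(l) *+ N)%MM *: (val x - v).
have vS' : kspan val (fun z => tdeg z = tdeg z0 /\ revlex_lt z z0)
    (mmap1 y (U_(l) *+ N)%MM *: v).
  apply: (@kspan_tmul _ _ _ _ y (fun j => ext_emb E phiL (e j)) _ _ _ _ _ vS).
  by move=> z [dz zx]; rewrite !tdegM dz; split=> //; exact: revlex_tmul.
have q'E : val z0 = mmap1 y (U_(l) *+ N)%MM *: v + q'.
  by rewrite ext_val_tmul /q' scalerBr addrC subrK.
rewrite -/(val _) q'E; apply: kspanD; first exact: vS'.
have := @ext_val_homog _ _ _ _ _ _ E _ phiL gL _ (tdeg z0) q' (tail_sub_span (NP l)).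
move=> /(_ _) H; apply: kspan_mono (H _) => [z [[k ik zk] dz]|].
  by split; [exact: dz|exact: revlex_lt_tail ik zk z00].
have -> : q' = val z0 - mmap1 y (U_(l) *+ N)%MM *: v by rewrite q'E addrC addKr.
apply: kspanB; first exact: ext_val_deg.
apply: kspan_trans vS' => z [<- _]; exact: ext_val_deg.
Qed.

(** With B_j a bound from Dickson's lemma for the nonstandard terms on e_j, at a
    term where the condition fails no exponent exceeds B_j: a nonstandard multiple
    by a power of y_l remains nonstandard when its exponents are truncated at B_j,
    and if that of y_l in x were larger the truncation would divide x. *)
Lemma generic_tail_closed : exists D,
  (forall j, (dlt j <= D)%N) /\ tail_closed dlt D generic_standard.
Proof.
have /choice[B BP] : forall j : 'I_r, exists B, forall m : 'X_{1..n},
    ~ generic_standard (m, j) -> ~ generic_standard ([multinom minn (m i) B | i < n], j).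
  move=> j; apply: (@dickson n (fun m => ~ generic_standard (m, j))) => m a nm nam.
  by apply: nm; apply: (@standard_down _ _ _ dlt _ _ _ a (m, j)).
pose D := (\max_j (n * B j + dlt j)).+1.
have DP j : (n * B j + dlt j < D)%N.
  exact: (@leq_bigmax _ (fun j => n * B j + dlt j)%N).
exists D; split=> [j|x i sx dx x0].
  by rewrite ltnW // (leq_ltn_trans _ (DP j)) // leq_addl.
apply: contrapT => /(generic_quasi_stable sx x0)[N NP].
have xB (l : 'I_n) : (x.1 l <= B x.2)%N.
  have [il|li] := ltnP i l; first by rewrite x0.
  rewrite leqNgt; apply/negP => Bx.
  have := BP x.2 _ (NP l li); apply.
  set m := [multinom _ | _ < n].
  apply: (@standard_down _ _ _ dlt _ _ _ (x.1 - m)%MM).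
  rewrite /tmul /= submK; first by rewrite -surjective_pairing.
  apply/mnm_lepP => p; rewrite mnmE mnmDE mulmnE mnm1E.
  have [<-|_] := eqVneq l p; first by rewrite (leq_trans (geq_minr _ _)) // ltnW.
  by rewrite mul0n geq_minl.
move: dx; rewrite leqNgt => /negP; apply; apply: leq_ltn_trans (DP x.2).
have <- : (\sum_(l < n) B x.2 = n * B x.2)%N by rewrite sum_nat_const card_ord.
by rewrite leq_add2r mdegE; exact: leq_sum.
Qed.

End GenericStandard.

(** * Specialization of the generic coordinates *)

Section Specialization.
Variables (K : fieldType) (n r : nat) (M : lmodType {mpoly K[n]}).
Variables (dlt : 'I_r -> nat) (e : 'I_r -> M) (E : graded_basis dlt e).
Notation R := {mpoly K[n * n]}.
Notation tdeg := (tdeg dlt).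
Notation valR := (ext_val E (poly_const K n) (generic_mx K n)).
Notation valL := (ext_val E (@frac_const K n) (@generic_frac K n)).
Notation tofrac := (@FracField.tofrac R).

Lemma ext_map_val (R1 R2 : comNzRingType) (phi1 : {rmorphism K -> R1})
    (phi2 : {rmorphism K -> R2}) (psi : {rmorphism R1 -> R2}) (g : 'M[R1]_n) x :
  (forall c, psi (phi1 c) = phi2 c) ->
  ext_map phi2 psi (ext_val E phi1 g x) = ext_val E phi2 (map_mx psi g) x.
Proof.
move=> h; rewrite /ext_val /term_val (ext_map_scale h) (ext_map_emb E h); congr (_ *: _).
rewrite /mmap1 rmorph_prod /=; apply: eq_bigr => i _.
by rewrite rmorphXn /= map_lin_form.
Qed.

(** A relation over the fractions becomes polynomial after multiplication by a
    nonzero polynomial, and can then be evaluated at a matrix. *)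
Lemma clear_relation S (u : base_ext E (poly_const K n)) :
  kspan valL S (frac_map u) ->
  exists2 f : R, f != 0 & kspan valR S (rscale f u).
Proof.
have H v : kspan valL S v -> exists2 f : R, f != 0 &
    exists2 w, rscale (tofrac f) v = frac_map w & kspan valR S w.
  elim=> [|c x w Sx _ [f f0 [w' ww' sw']]].
    by exists 1; [exact: oner_neq0|exists 0; [rewrite !raddf0|left]].
  have [d d0 [a da]] := frac_repr c.
  exists (d * f); first by rewrite mulf_neq0.
  exists (rscale (a * f) (valR x) + rscale d w'); last first.
    rewrite -!bext_scaleC; apply: kspan_cons; first exact: Sx.
    by apply: kspanZ; exact: sw'.
  rewrite !raddfD /= !frac_map_rscale bext_scaleC rscaleA.
  have -> : frac_map (valR x) = valL x by exact: ext_map_val.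
  by rewrite -ww' rscaleA !rmorphM /= mulrAC da.
move=> /H[f f0 [w fw sw]]; exists f => //.
suff -> : rscale f u = w by [].
by apply: frac_map_inj; rewrite frac_map_rscale.
Qed.

(** In degree D, standard for g implies standard generically, where F does not
    vanish.  This extends to higher degrees through the cones, and counting turns
    the inclusion into an equality. *)
Lemma tail_closed_open : exists (D : nat) (F : R),
  [/\ forall j, (dlt j <= D)%N, F != 0 &
    forall (k : fieldType) (phi : {rmorphism K -> k}) (g : 'M[k]_n),
      g \in unitmx -> mmap phi (mxvec g 0) F != 0 ->
      tail_closed dlt D (standard dlt (lin_form g) (fun j => ext_emb E phi (e j)))].
Proof.
have [D [dltD tcD]] := generic_tail_closed E.
have /choice[f fP] : forall x, exists f : R, f != 0 /\
    (~ generic_standard E x ->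
     kspan valR (fun z => tdeg z = tdeg x /\ revlex_lt z x) (rscale f (valR x))).
  move=> x; have [sx|/contrapT nsx] := pselect (generic_standard E x).
    by exists 1; rewrite oner_neq0.
  have [|f f0 fx] := @clear_relation (fun z => tdeg z = tdeg x /\ revlex_lt z x) (valR x).
    by have -> : frac_map (valR x) = valL x by exact: ext_map_val.
  by exists f.
exists D, (\prod_(x <- terms_of_deg n dlt D) f x); split=> //.
  by rewrite prodf_seq_neq0; apply/allP => x _; case: (fP x).
move=> k phi g gU F0.
set std := standard _ _ _.
pose psi : {rmorphism R -> k} := (mmap phi (mxvec g 0) : {rmorphism _ -> _}).
have psiC c : psi (poly_const K n c) = phi c by exact: mmapC.
have psi_val x : ext_map phi psi (valR x) = ext_val E phi g x.
  by rewrite (ext_map_val _ _ psiC) map_generic_mx.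
have std_gen x : std x -> tdeg x = D -> generic_standard E x.
  move=> sx dx; apply: contrapT => /(fP x).2 rel; apply: sx.
  have fx0 : psi (f x) != 0.
    move: F0; rewrite (rmorph_prod psi) prodf_seq_neq0 => /allP/(_ x) /=.
    by apply; rewrite terms_of_degP dx.
  have : kspan (ext_val E phi g) (fun z => tdeg z = tdeg x /\ revlex_lt z x)
      (ext_map phi psi (rscale (f x) (valR x))).
    elim: rel => [|c z u Sz _ IH]; first by rewrite raddf0; left.
    rewrite raddfD /= bext_scaleC (ext_map_rscale psiC) psi_val -bext_scaleC.
    exact: kspan_cons.
  rewrite (ext_map_rscale psiC) psi_val -bext_scaleC => /(kspanZ (psi (f x))^-1).
  by rewrite scalerA -mpolyCM mulVf // mpolyC1 scale1r.
have std_gen' x (i : 'I_n) : std x -> (D <= tdeg x)%N -> generic_standard E x.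
  move=> sx dx; have [m [w [hw lm xw]]] := head_exists dltD x.
  have sw : std w by apply: (@standard_down _ _ _ dlt _ _ _ m); rewrite -xw.
  have n0 : (0 < n)%N by exact: leq_ltn_trans (ltn_ord i).
  have dw : tdeg w = D.
    have [cw [cn|//]] := hw.
    by have := cut_tdeg cn n0; rewrite ltnNge dx.
  by rewrite xw; case: (head_cone tcD hw (std_gen w sw dw) lm).
have gen_std x (i : 'I_n) : generic_standard E x -> (D <= tdeg x)%N -> std x.
  move=> sx dx.
  have := @uniq_min_size _ (standard_list E phi g (tdeg x))
    (standard_list E (@frac_const K n) (@generic_frac K n) (tdeg x)).
  rewrite !size_standard_list // ?generic_frac_unit // leqnn => H.
  have [||//|_ eql] := H.
  - by apply: filter_uniq; exact: terms_of_deg_uniq.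
  - move=> z /standard_listP[sz dz]; apply/standard_listP; split; last exact: dz.
    by apply: std_gen'; [exact: i|exact: sz|rewrite dz].
  have : x \in standard_list E phi g (tdeg x) by rewrite eql; apply/standard_listP.
  by case/standard_listP.
move=> x i sx dx x0; apply: (gen_std _ i).
  by apply: tcD => //; exact: std_gen' i sx dx.
by rewrite tdegM (leq_trans dx) // leq_addl.
Qed.

End Specialization.

(** * Large finite extensions of a finite field *)

(** The splitting field of X^m - X, m a power of the characteristic, contains the
    m distinct roots of that polynomial. *)
Lemma finField_large_extension (F : finFieldType) (B : nat) :
  exists (L : fieldExtType F) (z : seq L), uniq z /\ (B < size z)%N.
Proof.
have [p pr_p pcharF] := finPcharP F.
pose m := (p ^ B.+1)%N.
have m_gt1 : (1 < m)%N by rewrite (ltn_exp2l 0) ?prime_gt1.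
have m_gt0 := ltnW m_gt1; have m1_gt0 : (m.-1 > 0)%N by rewrite -ltnS prednK.
pose q := fun R : nzRingType => ('X^m - 'X : {poly R}).
have Dq (R : nzRingType) : q R = ('X^(m.-1) - 1) * ('X - 0).
  by rewrite subr0 mulrBl mul1r -exprSr prednK.
have /FinSplittingFieldFor[/= L splitLq] : q F != 0.
  by rewrite Dq monic_neq0 ?rpredM ?monicXsubC ?monicXnsubC.
rewrite [map_poly _ _]rmorphB rmorphXn /= map_polyX -/(q L) in splitLq.
have pcharL : p \in [pchar L] by rewrite pchar_lalg.
have [zs DqL _] := splitLq.
exists L, zs; split.
  rewrite -separable_prod_XsubC -(eqp_separable DqL) Dq separable_root andbC.
  rewrite /root !hornerE subr_eq0 eq_sym expr0n gtn_eqF ?oner_eq0 //=.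
  rewrite cyclotomic.separable_Xn_sub_1 // -subn1 natrB // subr_eq0.
  by rewrite natrX pcharf0 // expr0n gtn_eqF // eq_sym oner_eq0.
have -> : size zs = m.
  apply: succn_inj; rewrite -(size_prod_XsubC _ id).
  by rewrite -(eqp_size DqL) size_polyDl size_polyXn // size_polyN size_polyX.
by apply: ltn_trans (ltn_expl B.+1 (prime_gt1 pr_p)).
Qed.

Section FiniteFieldAsFinField.
Variables (K : fieldType) (s : seq K).
Hypothesis sP : forall x, x \in s.

Lemma index_onthK : pcancel (fun x => index x s) (onth s).
Proof.
move=> x; have := sP x; elim: (s) => //= a t IH; rewrite inE.
by case: eqVneq => [->|ax] /= => [_|/IH //]; rewrite /= ?eqxx.
Qed.

Lemma undup_enum : Finite.axiom (undup s).
Proof. by move=> x; rewrite count_uniq_mem ?undup_uniq // mem_undup sP. Qed.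

End FiniteFieldAsFinField.

Lemma finite_field_large_extension (K : fieldType) (s : seq K) (B : nat) :
  (forall x, x \in s) ->
  exists (L : fieldExtType K) (z : seq L), uniq z /\ (B < size z)%N.
Proof.
(* taken apart, K is convertible to the field underlying the finite field on it *)
case: K s => K [? ? ? ? ? ? ? ? ? ? ? ? ? ? ?].
set F := GRing.Field.Pack _ => s sP.
pose cnt := isCountable.Build F (index_onthK sP).
pose K1 : countType := HB.pack_for countType K F cnt.
have sP1 : Finite.axiom (undup s : seq K1) by exact: (undup_enum sP).
pose fin := isFinite.Build K1 sP1.
pose K2 : finFieldType := HB.pack_for finFieldType K F cnt fin.
exact: (finField_large_extension K2 B).
Qed.

Lemma base_expansion_inj (N n : nat) (a b : nat -> nat) :
  (forall i, (i < n)%N -> (a i < N)%N) -> (forall i, (i < n)%N -> (b i < N)%N) ->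
  (\sum_(i < n) a i * N ^ i = \sum_(i < n) b i * N ^ i)%N ->
  forall i, (i < n)%N -> a i = b i.
Proof.
elim: n a b => // n IH a b ha hb.
have split (c : nat -> nat) :
    (\sum_(i < n.+1) c i * N ^ i = c 0 + (\sum_(i < n) c i.+1 * N ^ i) * N)%N.
  rewrite big_ord_recl expn0 muln1 big_distrl /=; congr (_ + _)%N.
  by apply: eq_bigr => i _; rewrite /bump /= add1n expnSr mulnA.
rewrite !split => e.
have e0 : a 0%N = b 0%N.
  by have := congr1 (modn^~ N) e; rewrite /= ![(_ + _ * N)%N]addnC !modnMDl !modn_small ?ha ?hb.
have N0 : (0 < N)%N by apply: leq_ltn_trans (ha 0%N _).
move: e; rewrite e0 => /addnI/eqP; rewrite eqn_pmul2r // => /eqP e.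
case=> // i i_n; apply: (IH (fun i => a i.+1) (fun i => b i.+1)) => // j jn.
  exact: ha.
exact: hb.
Qed.

(** The substitution x_i |-> X^(N^i) sends distinct monomials with exponents less
    than N to distinct powers of X. *)
Lemma kronecker_substitution (K : fieldType) (m : nat) (G : {mpoly K[m]}) : G != 0 ->
  exists (p : {poly K}) (N : nat), p != 0 /\
    forall (L : fieldExtType K) (z : L),
      mmap (in_alg L) (fun i : 'I_m => z ^+ (N ^ i)) G = (map_poly (in_alg L) p).[z].
Proof.
move=> G0; pose N := msize G.
pose p := mmap (@polyC K) (fun i : 'I_m => 'X^(N ^ i)) G.
have mon (a : 'X_{1..m}) :
    mmap1 (fun i : 'I_m => 'X^(N ^ i) : {poly K}) a = 'X^(\sum_i a i * N ^ i)%N.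
  rewrite /mmap1 (eq_bigr (fun i : 'I_m => 'X^(a i * N ^ i))) => [|i _].
    by rewrite prodrXr.
  by rewrite -exprM mulnC.
exists p, N; split=> [|L z].
  have a0 := mlead_supp G0; set a := mlead G in a0.
  have bnd (b : 'X_{1..m}) (i : 'I_m) : b \in msupp G -> (b i < N)%N.
    move=> /msize_mdeg_lt; apply: leq_ltn_trans; rewrite mdegE (bigD1 i) //=.
    exact: leq_addr.
  apply/eqP => p0; have := congr1 (fun q : {poly K} => q`_(\sum_i a i * N ^ i)%N) p0.
  rewrite /= coef0 /p /mmap coef_sum (bigD1_seq a) ?msupp_uniq //= mon coefCM coefXn.
  rewrite eqxx mulr1 big1_seq ?addr0 => [/eqP|b /andP[ba bG]].
    by rewrite mcoeff_eq0 a0.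
  rewrite mon coefCM coefXn; case: eqP => [e|_]; last by rewrite mulr0.
  case/eqP: ba; apply/mnmP => i.
  pose ex (c : 'X_{1..m}) j := if insub j is Some l then c l else 0%N.
  have exE c (l : 'I_m) : ex c l = c l by rewrite /ex valK.
  rewrite -!exE; apply: (@base_expansion_inj N m) => // [j jm|j jm|].
  - by rewrite -[j]/(val (Ordinal jm)) exE bnd.
  - by rewrite -[j]/(val (Ordinal jm)) exE bnd.
  by rewrite (eq_bigr (fun i : 'I_m => b i * N ^ i)%N) 1?[RHS](eq_bigr (fun i : 'I_m => a i * N ^ i)%N) //
    => l _; rewrite exE.
rewrite /p /mmap rmorph_sum horner_sum; apply: eq_bigr => a _ /=.
rewrite rmorphM /= map_polyC hornerM hornerC; congr (_ * _).
rewrite mon map_polyXn hornerXn /mmap1.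
rewrite (eq_bigr (fun i : 'I_m => z ^+ (a i * N ^ i))) => [|i _].
  by rewrite prodrXr.
by rewrite -exprM mulnC.
Qed.

Lemma finite_field_point (K : fieldType) (s : seq K) (m : nat) (G : {mpoly K[m]}) :
  (forall x, x \in s) -> G != 0 ->
  exists (L : fieldExtType K) (v : 'I_m -> L), mmap (in_alg L) v G != 0.
Proof.
move=> sP /kronecker_substitution[p [N [p0 pE]]].
have [L [zs [zs_uniq zs_large]]] := finite_field_large_extension (size p) sP.
have /allPn[z _ pz] : ~~ all (root (map_poly (in_alg L) p)) zs.
  apply/negP => /max_poly_roots; rewrite map_poly_eq0 p0 size_map_poly => /(_ isT zs_uniq).
  by rewrite ltnNge ltnW.
by exists L, (fun i => z ^+ (N ^ i)); rewrite pE.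
Qed.

(** * The tensor product with a finite extension *)

Section TensorExtension.
Variables (K : fieldType) (n : nat) (M : lmodType {mpoly K[n]}).
Variables (E : constant_basis M) (L : fieldExtType K).
Definition ext_const : {rmorphism K -> L} := in_alg L.
Notation ext := (base_ext E ext_const).
Notation beta := (@cb_vec _ _ _ E).

Definition tensor (u : M) (a : L) : ext := rscale a (ext_emb E ext_const u).

Lemma tensor_bilinear :
  bilinear_over (fun (c : K) (w : ext) => (c%:A : L)%:MP_[n] *: w) tensor.
Proof.
split=> [u v a|u a b|c u a|c u a]; rewrite /tensor.
- by rewrite !raddfD.
- by rewrite -!bext_scaleC mpolyCD scalerDl.
- by rewrite ext_embZ bext_scaleC !rscaleA mulrC.
by rewrite bext_scaleC rscaleA -[c *: a]mulr_algl.
Qed.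

Lemma const_scale_vec (c : K) a b :
  (c%:A : L)%:MP_[n] *: tensor (beta b) a = tensor (beta b) (c *: a).
Proof. by case: tensor_bilinear => _ _ _ ->. Qed.

Section Universal.
Variables (V : lmodType K) (f : M -> L -> V).
Hypothesis f_bil : bilinear_over (fun c w => c *: w) f.

Lemma bilinear_subl u v a : f (u - v) a = f u a - f v a.
Proof.
case: f_bil => fD _ fZ _; rewrite fD; congr (_ + _).
by rewrite -scaleN1r -mpolyC1 -mpolyCN fZ scaleN1r.
Qed.

Lemma bilinear_subr u : additive (f u).
Proof.
case: f_bil => _ fD _ fZ a b; rewrite fD; congr (_ + _).
by rewrite -scaleN1r fZ scaleN1r.
Qed.
HB.instance Definition _ u := GRing.isAdditive.Build L V (f u) (bilinear_subr u).

Definition bilinear_lift (w : ext) : V := fsum (fun b => f (beta b)) w.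

Lemma bilinear_liftB : {morph bilinear_lift : u v / u - v}.
Proof. exact: fsumB. Qed.
HB.instance Definition _ := GRing.isAdditive.Build ext V bilinear_lift bilinear_liftB.

Lemma bilinear_liftD : {morph bilinear_lift : u v / u + v}.
Proof. exact: raddfD. Qed.

Lemma bilinear_lift_vec a b : bilinear_lift (tensor (beta b) a) = f (beta b) a.
Proof. by rewrite /tensor -bextU; exact: fsumU. Qed.

Lemma bilinear_liftZ (c : K) w : bilinear_lift ((c%:A : L)%:MP_[n] *: w) = c *: bilinear_lift w.
Proof.
apply: (@bext_additive_ext _ _ _ _ _ _ _
  (fun w => bilinear_lift ((c%:A : L)%:MP_[n] *: w)) (fun w => c *: bilinear_lift w))
  => [u v|u v|a b].
- by rewrite scalerBr raddfB.
- by rewrite raddfB scalerBr.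
rewrite -/(tensor _ _) const_scale_vec !bilinear_lift_vec.
by case: f_bil => _ _ _ ->.
Qed.

Lemma bilinear_lift_tensor u a : bilinear_lift (tensor u a) = f u a.
Proof.
apply: (@module_additive_ext _ _ _ E _ (fun u => bilinear_lift (tensor u a)) (f^~ a))
  => [v w|v w|c b] /=.
- by rewrite /tensor !raddfB.
- exact: bilinear_subl.
case: tensor_bilinear => _ _ -> _; rewrite bilinear_liftZ bilinear_lift_vec.
by case: f_bil => _ _ -> _.
Qed.

End Universal.

(** A bilinear map is prescribed freely on the products of basis elements of M by
    scalars, and determined by these values. *)
Lemma tensor_base_extension : is_base_extension tensor.
Proof.
split.
- exact: tensor_bilinear.
- move=> V f f_bil; exists (bilinear_lift f); split.
  + by move=> v w; exact: (bilinear_liftD f_bil).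
  + exact: bilinear_liftZ.
  + exact: bilinear_lift_tensor.
- move=> V f f' fD _ f'D _ ff'; apply: (@bext_additive_ext _ _ _ _ _ _ _ f f').
  + move=> u v; have := fD (u - v) v; rewrite subrK => ->; by rewrite addrK.
  + move=> u v; have := f'D (u - v) v; rewrite subrK => ->; by rewrite addrK.
  + by move=> a b; exact: ff'.
move=> p a u a'.
rewrite -scalerA bext_scale_map /tensor ext_op_rscale ext_op_emb.
by rewrite bext_scaleC rscaleA.
Qed.

Variable Md : int -> set M.

Lemma base_ext_grading0 d : base_ext_grading Md tensor d 0.
Proof.
by exists 0%N, (fun=> 0), (fun=> 0); split; [case|rewrite big_ord0].
Qed.

Lemma base_ext_gradingD d u v : base_ext_grading Md tensor d u ->
  base_ext_grading Md tensor d v -> base_ext_grading Md tensor d (u + v).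
Proof.
move=> [p [x [a [xd ->]]]] [q [x' [a' [xd' ->]]]].
exists (p + q)%N, (fun j => match split j with inl i => x i | inr i => x' i end),
  (fun j => match split j with inl i => a i | inr i => a' i end); split.
  by move=> j; case: (split j).
by rewrite big_split_ord /=; congr (_ + _); apply: eq_bigr => i _;
  [rewrite (unsplitK (inl i))|rewrite (unsplitK (inr i))].
Qed.

Lemma base_ext_grading_gen d u a : Md d u -> base_ext_grading Md tensor d (tensor u a).
Proof.
by move=> ud; exists 1%N, (fun=> u), (fun=> a); split=> //; rewrite big_ord1.
Qed.

Lemma base_ext_gradingZ d c w : base_ext_grading Md tensor d w ->
  base_ext_grading Md tensor d (c%:MP *: w).
Proof.
move=> [p [x [a [xd ->]]]]; exists p, x, (fun j => c * a j); split=> //.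
by rewrite scaler_sumr; apply: eq_bigr => j _; rewrite bext_scaleC rscaleA.
Qed.

End TensorExtension.

(** * Conclusion *)

(** Extension along the identity, which identifies M with base_ext E idfun. *)
Section Transport.
Variables (K : fieldType) (n : nat) (M : lmodType {mpoly K[n]}).
Variables (E : constant_basis M).
Notation id_const := (idfun : {rmorphism K -> K}).
Notation emb := (ext_emb E id_const).

Lemma ext_emb_id_inj : injective emb.
Proof.
move=> u v uv; rewrite -(coordK E u) -(coordK E v); congr (combine _).
apply/eqP/freeg_eqP => b.
have := congr1 (fun w : {freeg (cb_index E) / K} => coeff b w) uv.
by rewrite /ext_emb /= !coeff_freeg_map.
Qed.

Lemma kspan_emb_id (I : Type) (f : I -> M) S u :
  kspan (fun i => emb (f i)) S (emb u) -> kspan f S u.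
Proof.
have H v : kspan (fun i => emb (f i)) S v -> exists2 w, v = emb w & kspan f S w.
  elim=> [|c i w Si _ [w' -> sw']]; first by exists 0; [rewrite raddf0|left].
  exists (c%:MP *: f i + w'); last exact: kspan_cons.
  by rewrite raddfD /= ext_embZ bext_scaleC.
by move=> /H[w /ext_emb_id_inj ->].
Qed.

Lemma kfree_emb_id (I : eqType) (f : I -> M) S :
  kfree (fun i => emb (f i)) S -> kfree f S.
Proof.
move=> fr s c us sS e0; apply: fr => //.
have := congr1 emb e0; rewrite raddf0 raddf_sum => e1; rewrite -[RHS]e1.
by apply: eq_bigr => i _ /=; rewrite ext_embZ bext_scaleC.
Qed.

End Transport.

Theorem theorem4p3p4 (K : fieldType) (n : nat) (M : lmodType {mpoly K[n]})
    (Md : int -> set M) (hMd : is_grading Md) (hM : fin_generated M) :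
  (infinite_set [set: K]%classic ->
     generic_GL (fun g : 'M[K]_n =>
       exists N : 'I_n.+1 -> set M, filtered_Stanley_decomposition Md g N))
  /\
  (finite_set [set: K]%classic ->
     exists (K' : fieldExtType K) (M' : lmodType {mpoly K'[n]})
            (t : M -> K' -> M'),
       is_base_extension t /\
       exists g : 'M[K']_n, g \in unitmx /\
         exists N : 'I_n.+1 -> set M',
           filtered_Stanley_decomposition (base_ext_grading Md t) g N).
Proof.
have [r [e [dlt [base [e_homog e_gen]]]]] := homog_generators hMd hM.
(* standard terms in the original coordinates form the basis used to extend scalars *)
pose E := standard_graded_basis hMd e_homog e_gen.
have [D [F [dltD F0 FP]]] := tail_closed_open E.
split=> [_|].
  exists F => // g gU Fg.
  have tc := FP K idfun g gU Fg.
  have valE x : ext_emb E idfun (term_val (tnth (new_coord g)) e x) = ext_val E idfun g x.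
    by rewrite new_coordE ext_emb_term map_mx_id.
  apply: (@cone_decomposition _ _ _ _ Md base dlt D g e dltD _ _ _ _ _ tc).
  - exact: (grading0 hMd).
  - exact: grading_add.
  - by move=> c x; rewrite new_coordE; exact: term_val_homog.
  - by move=> m x; exact: standard_down.
  - apply: (@kfree_emb_id _ _ _ E); rewrite (funext valE); exact: ext_standard_free.
  - move=> u; apply: (@kspan_emb_id _ _ _ E); rewrite (funext valE).
    exact: (ext_standard_span gU).
move=> /finite_seqP[s Ks].
have sP x : x \in s by have : [set` s]%classic x by rewrite -Ks.
have FD0 : F * \det (generic_mx K n) != 0 by rewrite mulf_neq0 ?det_generic_neq0.
have [K' [v vP]] := finite_field_point sP FD0.
pose g : 'M[K']_n := vec_mx (\row_i v i).
have gv : mxvec g 0 =1 v by move=> i; rewrite vec_mxK mxE.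
have mE (G : {mpoly K[n * n]}) : mmap (in_alg K') (mxvec g 0) G = mmap (in_alg K') v G.
  by apply: eq_bigr => m _; congr (_ * _); exact: mmap1_eq.
move: vP; rewrite -mE rmorphM mulf_eq0 negb_or => /andP[Fg Dg].
have gU : g \in unitmx.
  by rewrite unitmxE unitfE; move: Dg; rewrite -det_map_mx map_generic_mx.
exists K', (base_ext E (ext_const K')), (tensor E (L := K')); split.
  exact: tensor_base_extension.
exists g; split=> //.
have tc := FP K' (ext_const K') g gU Fg.
apply: (@cone_decomposition _ _ _ _ (base_ext_grading Md (tensor E (L := K')))
  base dlt D g (fun j => ext_emb E (ext_const K') (e j)) dltD _ _ _ _ _ tc).
- exact: base_ext_grading0.
- exact: base_ext_gradingD.
- move=> c x; rewrite new_coordE -[g]mulmx1; apply: base_ext_gradingZ.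
  have := term_val_change dlt 1%:M g (fun j => ext_emb E (ext_const K') (e j)) x.
  elim=> [|a z u dz _ IH]; first exact: base_ext_grading0.
  apply: base_ext_gradingD => //; apply: base_ext_gradingZ.
  rewrite -/(ext_val _ _ _) -ext_emb_term1 -[ext_emb _ _ _]rscale1 -/(tensor _ _ _).
  apply: base_ext_grading_gen.
  rewrite -[term_val _ _ _]scale1r -mpolyC1 -dz.
  exact: term_val_homog.
- by move=> m x; exact: standard_down.
- rewrite new_coordE; exact: ext_standard_free.
- rewrite new_coordE; exact: (ext_standard_span gU).
Qed.
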